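(* Let $u\colon\mathbb{Z}\to\mathbb{R}$ be a not identically vanishing single site potential for which there exist $s\in(0,1)$ and $C\in(0,\infty)$ with $|u(k)|\le C s^{|k|}$ for all $k\in\mathbb{Z}$. Consider the discrete alloy-type model $H_\omega=H_0+V_\omega$ on $\ell^2(\mathbb{Z})$ with single site potential $u$ and coupling constants with density $f\in BV$, and assume that $f$ has compact support. Then there exist $c_u\in(0,\infty)$ and $D\in\mathbb{N}_0$ depending only on $u$ such that for each $\beta>D/|\log s|$ there exists a constant $K_\beta\in(0,\infty)$ such that for all $L\in\mathbb{N}$, $E\in\mathbb{R}$ and $\epsilon>0$, \[ \mathbb{E}\left\{\mathrm{Tr}\big[\chi_{[E-\epsilon,E+\epsilon]}(H_{\omega,L})\big]\right\}\le\frac{8}{c_u}\,\|f\|_{BV}\,\epsilon\,L\,(L+\beta\log L+K_\beta)^{D+1}. \]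
   Context: $\mathbb{N}=\{1,2,\dots\}$, $\mathbb{N}_0=\mathbb{N}\cup\{0\}$. Discrete alloy-type model in dimension one: $H_0$ is an arbitrary symmetric operator on $\ell^2(\mathbb{Z})$ (with the finitely supported functions in its domain). The random potential $V_\omega$ is the multiplication operator by $V_\omega(x)=\sum_{k\in\mathbb{Z}}\omega_k\,u(x-k)$, where $(\omega_k)_{k\in\mathbb{Z}}$ are i.i.d. real random variables, each having a probability density $f$, and $u$ is the single site potential. $\mathbb{E}$ denotes expectation with respect to the product measure of the $\omega_k$. $BV$ denotes the space of functions on $\mathbb{R}$ of bounded total variation, and $\|f\|_{BV}$ is the total variation of $f$. For $L\in\mathbb{N}$ let $\Lambda_L=\{0,\dots,L\}$, let $\iota_L\colon\ell^2(\Lambda_L)\to\ell^2(\mathbb{Z})$ be the canonical inclusion and $\pi_L\colon\ell^2(\mathbb{Z})\to\ell^2(\Lambda_L)$ its adjoint (restriction). The finite box restriction is the selfadjoint operator $H_{\omega,L}=\pi_LH_0\iota_L+V_\omega\chi_{\Lambda_L}$ on the finite dimensional space $\ell^2(\Lambda_L)$. $\chi_I$ is the indicator function of $I$, so $\mathrm{Tr}[\chi_I(H_{\omega,L})]$ is the number of eigenvalues of $H_{\omega,L}$ in $I$, counted with multiplicity. *)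

(* Defs.v *)
From HB Require Import structures.
From mathcomp Require Import all_boot all_order all_algebra finmap.
From mathcomp Require Import spectral complex.
From mathcomp Require Import all_classical all_reals all_analysis.

Set Implicit Arguments.
Unset Strict Implicit.
Unset Printing Implicit Defensive.

Import Order.TTheory GRing.Theory Num.Theory.
Import numFieldNormedType.Exports.

Local Open Scope classical_set_scope.
Local Open Scope ring_scope.
Local Open Scope complex_scope.

(* Sum over Z, as the limit of the sums over {-n, ..., n}; it is only
   meaningful (and only used) for absolutely convergent families. *)
Definition sumZ (K : numFieldType) (a : int -> K) : K :=
  lim ((fun n : nat => \sum_(i < n.*2.+1) a (i%:Z - n%:Z)) @ \oo).

Section Operators.
Context {R : realType}.
Local Notation C := R[i].

Definition l2Z (phi : int -> C) : Prop :=
  summable [set: int] (fun k => (Normc.normc (phi k) ^+ 2)%:E).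

Definition innerZ (phi psi : int -> C) : C :=
  sumZ (fun k => (phi k)^* * psi k).

(* A possibly unbounded symmetric operator on l^2(Z) whose domain contains the
   finitely supported functions; outside [op_dom] the values are irrelevant. *)
Record symmetric_operator := SymmetricOperator {
  op_dom : set (int -> C);
  op_fun :> (int -> C) -> (int -> C);
  op_dom_l2 : op_dom `<=` [set phi | l2Z phi];
  op_dom_linear : forall (a : C) phi psi, op_dom phi -> op_dom psi ->
    op_dom (fun k => a * phi k + psi k);
  op_dom_finsupp : forall phi, finite_set [set k | phi k != 0] -> op_dom phi;
  op_fun_l2 : forall phi, op_dom phi -> l2Z (op_fun phi);
  op_fun_linear : forall (a : C) phi psi, op_dom phi -> op_dom psi ->
    op_fun (fun k => a * phi k + psi k)
    = (fun k => a * op_fun phi k + op_fun psi k);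
  op_fun_symmetric : forall phi psi, op_dom phi -> op_dom psi ->
    innerZ (op_fun phi) psi = innerZ phi (op_fun psi)
}.

(* The box {0, ..., L} is indexed by 'I_L.+1. *)
Definition box_incl (L : nat) (v : 'cV[C]_L.+1) : int -> C :=
  fun k => \sum_(i < L.+1) (if k == i%:Z then v i 0 else 0).

Definition box_restr (L : nat) (phi : int -> C) : 'cV[C]_L.+1 :=
  \col_(i < L.+1) phi i%:Z.

(* Matrix, in the canonical basis of l^2({0, ..., L}), of the box restriction
   of H0 + V. *)
Definition box_hamiltonian (H0 : symmetric_operator) (V : int -> R) (L : nat) :
    'M[C]_L.+1 :=
  (\matrix_(i < L.+1, j < L.+1)
      box_restr L (H0 (box_incl (delta_mx j 0))) i 0)
  + diag_mx (\row_(i < L.+1) (V i%:Z)%:C).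

(* Functional calculus g(A) for a Hermitian matrix A, through the spectral
   decomposition A = P^-1 diag(lambda) P with P unitary and lambda real. *)
Definition spectral_calculus (g : R -> R) n (A : 'M[C]_n) : 'M[C]_n :=
  invmx (spectralmx A)
  *m diag_mx (map_mx (fun z : C => (g (complex.Re z))%:C) (spectral_diag A))
  *m spectralmx A.

Definition trace_spectral_projection (I : set R) n (A : 'M[C]_n) : R :=
  complex.Re (\tr (spectral_calculus \1_I A)).

(* Total variation on the whole line of the function itself (not of its
   almost-everywhere class). *)
Definition total_variationR (f : R -> R) : \bar R :=
  ereal_sup [set total_variation ab.1 ab.2 f
            | ab in [set ab : R * R | ab.1 <= ab.2]].

Definition in_BV (f : R -> R) : Prop := (total_variationR f < +oo)%E.

Definition BVnorm (f : R -> R) : R := fine (total_variationR f).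

Definition compact_support (f : R -> R) : Prop :=
  compact (closure [set x | f x != 0]).

Definition exp_decay (u : int -> R) (s K : R) : Prop :=
  forall k : int, `|u k| <= K * s ^+ `|k|%N.

End Operators.

Section Probability.
Context {R : realType} {d : measure_display} {T : measurableType d}.
Variable P : probability T R.

Definition has_density (X : {RV P >-> R}) (f : R -> R) : Prop :=
  [/\ measurable_fun [set: R] f,
      (forall x, 0 <= f x) &
      forall A : set R, measurable A ->
        distribution P X A = (\int[lebesgue_measure]_(x in A) (f x)%:E)%E].

Definition mutually_independent (X : int -> {RV P >-> R}) : Prop :=
  forall (J : {fset int}) (A : int -> set R), (forall k, measurable (A k)) ->
    P (\bigcap_(k in [set` J]) (X k @^-1` A k))
    = (\prod_(k <- J) P (X k @^-1` A k))%E.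

Definition alloy_potential (omega : int -> {RV P >-> R}) (u : int -> R)
    (w : T) (x : int) : R :=
  sumZ (fun k => omega k w * u (x - k)).

End Probability.

(* Main.v *)
Require Import Defs.
From HB Require Import structures.
From mathcomp Require Import all_boot all_order all_algebra finmap.
From mathcomp Require Import spectral complex.
From mathcomp Require Import all_classical all_reals all_analysis.
From mathcomp Require Import measurable_realfun zify ring lra.

Set Implicit Arguments.
Unset Strict Implicit.
Unset Printing Implicit Defensive.

Import Order.TTheory GRing.Theory Num.Theory.
Import numFieldNormedType.Exports.

Local Open Scope classical_set_scope.
Local Open Scope ring_scope.

(** Let [D] be the order of the first nonvanishing moment of [u] and [m] that
    moment.  As all lower moments vanish, expanding [(x - k) ^ D] leaves only
    its top term:  sum_k k^D u(x - k) = (-1)^D m  for every site [x]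
    ([convolution_pow]).  So moving the coupling constants in the direction
    k |-> k^D raises the potential by a constant, although [u] itself may
    change sign.  Such a [D] exists ([first_nonzero_moment]): if all moments
    vanished, the Fourier transform of [u], which is analytic in a strip, would
    vanish identically.  The proof of [all_moments_eq0] does this on the side of
    the test functions: those annihilated by [u] contain the polynomials, hence
    cosines of small frequency by Taylor expansion, hence all cosines by the
    doubling formula, hence products of cosines which converge to a point mass.

    Only the coupling constants with |k| <= N are moved, where [N] is the
    integer part of L + beta ln L + K.  On the box the omitted part of the sum
    is at most about L^D e^{-g (beta ln L + K)}, where e^{-g} is a decay rate
    slightly weaker than [s].  Since beta > D / |ln s|, [g] can be chosen with
    g beta >= D; the powers of [L] then cancel, and a large [K] makes the
    omitted part smaller than |m| / 2 ([window_lower_bound]).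

    Shifting each omega_k, |k| <= N, by +- t k^D thus raises the potential on
    the box by at least t |m| / 2.  If this exceeds the length of the energy
    interval, min-max shows that the number of eigenvalues in the interval is at
    most #{eigenvalues <= lam} before the shift minus the same number after it
    ([trace_interval_le], [eigenvalue_count_shift]).  The expectation of such a
    difference is estimated one coordinate at a time: shifting one variable of
    density [f] by [h] changes the mean of a function with values in [0, B] by
    at most h B ||f||_BV.  With B = L + 1 and total shift t sum_{|k| <= N}
    |k|^D <= t (2 N + 1) N^D, this is the claimed bound.

    The last estimate is carried out on finite sums, which spares any discussion
    of the measurability of eigenvalue counts.  The variables omega_k, |k| <= n,
    are rounded to a grid and the others are replaced by [0], which moves the
    potential on the box by at most eps / 2 ([truncated_potential_close]).
    Outside a null set the trace is then dominated by a simple function, whose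
    integral is by independence a finite sum against products of cell masses
    ([expectation_shift_le]).  Shifting a coordinate by one grid step becomes a
    summation by parts in that sum ([grid_mean_step_up]), and the increments of
    the cell masses add up to at most the mesh times ||f||_BV
    ([cell_increment_sum]). *)

(** * Symmetric sums over the integers *)

Definition psumZ (K : numFieldType) (a : int -> K) (n : nat) : K :=
  \sum_(i < n.*2.+1) a (i%:Z - n%:Z).

Lemma psumZ0 (K : numFieldType) (a : int -> K) : psumZ a 0 = a 0.
Proof. by rewrite /psumZ big_ord1. Qed.

Lemma psumZS (K : numFieldType) (a : int -> K) n :
  psumZ a n.+1 = psumZ a n + (a n.+1%:Z + a (- n.+1%:Z)).
Proof.
rewrite /psumZ doubleS big_ord_recl big_ord_recr/=.
rewrite [LHS]addrC -[LHS]addrA; congr (_ + (_ + _)).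
- by apply: eq_bigr => i _; congr a; rewrite /= /bump/=; lia.
- by congr a; rewrite /= /bump/=; lia.
- by congr a; lia.
Qed.

Lemma psumZ_single (K : numFieldType) (a : int -> K) (i : int) (n : nat) :
  (forall k : int, k != i -> a k = 0) -> (`|i| <= n)%N -> psumZ a n = a i.
Proof.
move=> a0 le_in; have h : (absz (i + n%:Z)%R < n.*2.+1)%N by lia.
rewrite /psumZ (bigD1 (Ordinal h))//= big1 ?addr0; first by congr a; lia.
move=> j /eqP jh; apply: a0; apply/eqP => e; apply: jh; apply/val_inj => /=; lia.
Qed.

Lemma sumZ_single (K : numFieldType) (a : int -> K) (i : int) :
  (forall k : int, k != i -> a k = 0) -> sumZ a = a i.
Proof.
move=> a0; apply: (@lim_near_cst K^o); first exact: norm_hausdorff.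
by exists `|i|%N => // n /= le_in; exact: psumZ_single.
Qed.

Lemma psumZ_truncate (K : numFieldType) (a : int -> K) (N n : nat) : (N <= n)%N ->
  psumZ (fun k => if (`|k| <= N)%N then a k else 0) n = psumZ a N.
Proof.
move=> /subnKC <-; elim: (n - N)%N => [|p IH].
  rewrite addn0 /psumZ; apply: eq_bigr => i _; rewrite ifT//.
  by have := ltn_ord i; lia.
rewrite addnS psumZS IH !ifF ?addr0//; lia.
Qed.

Section RealSums.
Variable R : realType.
Implicit Types (a b : int -> R) (q B : R).

(** The factor [1 - q ^+ p] leaves room for one more geometric term at each step
    of the induction on [p]. *)
Lemma psumZ_tail a q B n p : 0 <= q -> q < 1 -> exp_decay a q B ->
  `|psumZ a (n + p)%N - psumZ a n| <= 2 * B * q ^+ n.+1 * (1 - q ^+ p) / (1 - q).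
Proof.
move=> q0 q1 ha; have q1' : 1 - q != 0 by rewrite subr_eq0 gt_eqF.
elim: p => [|p IH]; first by rewrite addn0 subrr normr0 expr0 subrr mulr0 mul0r.
rewrite addnS psumZS addrAC (le_trans (ler_normD _ _))//.
apply: (le_trans (lerD IH (ler_normD _ _))).
have h1 := ha (n + p).+1%:Z; have h2 := ha (- (n + p).+1%:Z).
rewrite abszN in h2; rewrite absz_nat in h1 h2.
apply: (le_trans (lerD (lexx _) (lerD h1 h2))).
by rewrite le_eqVlt !exprS exprD; apply/orP; left; apply/eqP; field.
Qed.

Lemma psumZ_tail_le a q B n p : 0 <= q -> q < 1 -> exp_decay a q B ->
  `|psumZ a (n + p)%N - psumZ a n| <= 2 * B * q ^+ n.+1 / (1 - q).
Proof.
move=> q0 q1 ha; apply: (le_trans (psumZ_tail n p q0 q1 ha)).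
have B0 : 0 <= B by have := ha 0; rewrite expr0 mulr1; apply: le_trans.
have q1' : 0 < 1 - q by rewrite subr_gt0.
apply: ler_wpM2r; first by rewrite invr_ge0 ltW.
rewrite ler_piMr// ?mulr_ge0// ?exprn_ge0//.
by rewrite gerBl exprn_ge0.
Qed.

Lemma exp_decay_cvg a q B : 0 <= q -> q < 1 -> exp_decay a q B ->
  psumZ a @ \oo --> sumZ a.
Proof.
move=> q0 q1 ha; rewrite /sumZ -/(psumZ a).
have aE : psumZ a = fun n => a 0 + series (fun i => a i.+1%:Z + a (- i.+1%:Z)) n.
  apply/funext; elim => [|n IH]; first by rewrite psumZ0 seriesEord/= big_ord0 addr0.
  by rewrite psumZS IH !seriesEord/= big_ord_recr/= !addrA.
suff : cvgn (series (fun i => a i.+1%:Z + a (- i.+1%:Z))).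
  move=> h; rewrite [X in cvg_to _ (nbhs (lim (X @ \oo)))]aE aE.
  by apply: is_cvgD => //; exact: is_cvg_cst.
apply: normed_cvg.
apply: (@series_le_cvg _ _ (geometric (2 * B * q) q)) => [n|n|n|].
- exact: normr_ge0.
- rewrite /= /geometric/= mulr_ge0// ?exprn_ge0// !mulr_ge0//.
  by have := ha 0; rewrite expr0 mulr1; apply: le_trans.
- rewrite /geometric/= (le_trans (ler_normD _ _))//.
  apply: (le_trans (lerD (ha _) (ha _))); rewrite abszN absz_nat exprS.
  by rewrite le_eqVlt; apply/orP; left; apply/eqP; ring.
- by apply: is_cvg_geometric_series; rewrite ger0_norm.
Qed.

Lemma sumZ_tail a q B n : 0 <= q -> q < 1 -> exp_decay a q B ->
  `|sumZ a - psumZ a n| <= 2 * B * q ^+ n.+1 / (1 - q).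
Proof.
move=> q0 q1 ha.
have : (fun m => `|psumZ a m - psumZ a n|) @ \oo --> `|sumZ a - psumZ a n|.
  apply: cvg_norm; apply: cvgB; first exact: exp_decay_cvg ha.
  exact: cvg_cst.
move/cvgr_to_le; apply; exists n => // m /= nm.
by rewrite -(subnKC nm); exact: psumZ_tail_le.
Qed.

Lemma cvg_sumZ a l : psumZ a @ \oo --> l -> sumZ a = l.
Proof. by move=> h; apply: cvg_lim h; exact: norm_hausdorff. Qed.

Lemma exp_decay_expr0 a q B : exp_decay a q B -> 0 <= B.
Proof. by move/(_ 0); rewrite expr0 mulr1; apply: le_trans. Qed.

Lemma psumZD a b n : psumZ (fun k => a k + b k) n = psumZ a n + psumZ b n.
Proof. exact: big_split. Qed.

Lemma psumZM c a n : psumZ (fun k => c * a k) n = c * psumZ a n.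
Proof. by rewrite /psumZ mulr_sumr. Qed.

Lemma exp_decayM c a q B : exp_decay a q B ->
  exp_decay (fun k => c * a k) q (`|c| * B).
Proof. by move=> ha k; rewrite normrM -mulrA ler_wpM2l. Qed.

Lemma sumZD a b q B B' : 0 <= q -> q < 1 ->
  exp_decay a q B -> exp_decay b q B' ->
  sumZ (fun k => a k + b k) = sumZ a + sumZ b.
Proof.
move=> q0 q1 ha hb; apply: cvg_sumZ.
rewrite (funext (psumZD a b)).
by apply: cvgD; [exact: exp_decay_cvg ha|exact: exp_decay_cvg hb].
Qed.

Lemma sumZM c a q B : 0 <= q -> q < 1 -> exp_decay a q B ->
  sumZ (fun k => c * a k) = c * sumZ a.
Proof.
move=> q0 q1 ha; apply: cvg_sumZ.
rewrite (funext (psumZM c a)).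
by apply: cvgMr; exact: exp_decay_cvg ha.
Qed.

Lemma psumZ_shift a n :
  psumZ (fun k => a (k + 1)) n = psumZ a n + (a n.+1%:Z - a (- n%:Z)).
Proof.
elim: n => [|n IH]; first by rewrite !psumZ0 add0r oppr0 addrC subrK.
rewrite psumZS IH psumZS.
have -> : n.+1%:Z + 1 = n.+2%:Z by lia.
have -> : - n.+1%:Z + 1 = - n%:Z by lia.
by ring.
Qed.

Lemma exp_decay_shift a q B : 0 < q -> q < 1 -> exp_decay a q B ->
  forall x, exp_decay (fun k => a (k + x)) q (B / q ^+ `|x|%N).
Proof.
move=> q0 q1 ha x k; apply: (le_trans (ha _)).
rewrite -mulrA ler_wpM2l ?(exp_decay_expr0 ha)//.
rewrite mulrC ler_pdivlMr ?exprn_gt0// -exprD.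
by apply: ler_wiXn2l; [exact: ltW|exact: ltW|lia].
Qed.

Lemma cvg_expr_decay a q B (f : nat -> int) : 0 <= q -> q < 1 -> exp_decay a q B ->
  (forall n, (n <= `|f n|)%N) -> a (f n) @[n --> \oo] --> (0 : R).
Proof.
move=> q0 q1 ha hf; apply/norm_cvg0P.
apply: (@squeeze_cvgr _ _ _ _ (cst 0) (geometric B q)).
- near=> n; rewrite normr_ge0/= (le_trans (ha _))//.
  rewrite ler_wpM2l ?(exp_decay_expr0 ha)//.
  by apply: ler_wiXn2l => //; exact: ltW.
- exact: cvg_cst.
- by apply: cvg_geometric; rewrite ger0_norm.
Unshelve. all: end_near. Qed.

Lemma sumZ_shift1 a q B : 0 < q -> q < 1 -> exp_decay a q B ->
  sumZ (fun k => a (k + 1)) = sumZ a.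
Proof.
move=> q0 q1 ha; apply: cvg_sumZ.
rewrite (funext (psumZ_shift a)).
rewrite -[X in _ --> X]addr0; apply: cvgD; first exact: exp_decay_cvg (ltW q0) q1 ha.
rewrite -[X in _ --> X](subrr 0); apply: cvgB.
  by apply: (@cvg_expr_decay a q B (fun n => n.+1%:Z) (ltW q0) q1 ha) => n; lia.
by apply: (@cvg_expr_decay a q B (fun n => - n%:Z) (ltW q0) q1 ha) => n; lia.
Qed.

Lemma sumZ_shift a q B x : 0 < q -> q < 1 -> exp_decay a q B ->
  sumZ (fun k => a (k + x)) = sumZ a.
Proof.
move=> q0 q1 ha.
have nat_shift b B' (m : nat) : exp_decay b q B' ->
    sumZ (fun k => b (k + m%:Z)) = sumZ b.
  move=> hb; elim: m => [|m IH]; first by under eq_fun do rewrite addr0.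
  rewrite -IH -(sumZ_shift1 q0 q1 (exp_decay_shift q0 q1 hb m%:Z)).
  by congr sumZ; apply/funext => k; congr b; lia.
case: x => m; first exact: nat_shift ha.
rewrite -(nat_shift _ _ m.+1 (exp_decay_shift q0 q1 ha (Negz m))).
by congr sumZ; apply/funext => k; congr a; lia.
Qed.

Lemma sumZ_opp a : sumZ (fun k => a (- k)) = sumZ a.
Proof.
rewrite /sumZ; congr (lim (_ @ \oo)); apply/funext.
have H n : psumZ (fun k => a (- k)) n = psumZ a n; last exact: H.
elim: n => [|n IH]; first by rewrite !psumZ0 oppr0.
by rewrite !psumZS IH opprK [a _ + _ in LHS]addrC.
Qed.

(** Dominated convergence, for limits of null sums.  The tail bound of each
    [a_ N] makes its partial sums small uniformly in [N]; this passes to the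
    partial sums of the limit. *)
Lemma sumZ_dominated (a_ : nat -> int -> R) a q B : 0 <= q -> q < 1 ->
  (forall N, exp_decay (a_ N) q B) -> (forall k, a_ N k @[N --> \oo] --> a k) ->
  (forall N, sumZ (a_ N) = 0) -> sumZ a = 0.
Proof.
move=> q0 q1 ha hcvg h0.
have pcvg n : psumZ (a_ N) n @[N --> \oo] --> psumZ a n.
  elim: n => [|n IH].
    by rewrite psumZ0; under eq_fun do rewrite psumZ0; exact: hcvg.
  rewrite psumZS; under eq_fun do rewrite psumZS.
  by apply: cvgD => //; apply: cvgD; exact: hcvg.
have bnd n : `|psumZ a n| <= 2 * B * q ^+ n.+1 / (1 - q).
  have : `|psumZ (a_ N) n| @[N --> \oo] --> `|psumZ a n| by exact: cvg_norm.
  move/cvgr_to_le; apply; near=> N.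
  by have := sumZ_tail n q0 q1 (ha N); rewrite h0 sub0r normrN.
apply: cvg_sumZ; apply/norm_cvg0P.
apply: (@squeeze_cvgr _ _ _ _ (cst 0) (geometric (2 * B * q / (1 - q)) q)).
- near=> n; rewrite normr_ge0/= (le_trans (bnd n))// /geometric/= exprS.
  by rewrite le_eqVlt; apply/orP; left; apply/eqP; ring.
- exact: cvg_cst.
- by apply: cvg_geometric; rewrite ger0_norm.
Unshelve. all: end_near. Qed.

End RealSums.

(** * Moments of an exponentially decaying sequence *)

Section Moments.
Variable R : realType.

(** From [1 + y <= expR y] at y = t n / (d + 1), raised to the power [d]. *)
Lemma natX_le_geom (r : R) (d : nat) : 1 < r ->
  exists2 B : R, 0 <= B & forall n : nat, n%:R ^+ d <= B * r ^+ n.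
Proof.
move=> r1; have r0 : 0 < r by apply: lt_trans r1.
pose t := ln r; have t0 : 0 < t by rewrite ln_gt0.
have d0 : 0 < d.+1%:R / t by rewrite divr_gt0// ltr0n.
exists ((d.+1%:R / t) ^+ d); first by rewrite exprn_ge0// ltW.
move=> n; have h : n%:R <= d.+1%:R / t * expR (t * n%:R / d.+1%:R).
  rewrite mulrC -ler_pdivrMr// invf_div mulrA [n%:R * t]mulrC.
  by apply: le_trans (expR_ge1Dx _); rewrite lerDr.
apply: (@le_trans _ _ ((d.+1%:R / t * expR (t * n%:R / d.+1%:R)) ^+ d)).
  by apply: lerXn2r; rewrite ?nnegrE// mulr_ge0 ?expR_ge0// ltW.
rewrite exprMn ler_wpM2l ?exprn_ge0 ?(ltW d0)//.
have -> : r ^+ n = expR (t * n%:R) by rewrite expRM_natr lnK.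
rewrite -expRM_natr ler_expR -!mulrA ler_wpM2l ?(ltW t0)// ler_piMr//.
by rewrite mulrC ler_pdivrMr ?ltr0n// mul1r ler_nat.
Qed.

Lemma poly_le_geom (r : R) (p : {poly R}) : 1 < r ->
  exists2 B : R, 0 <= B & forall k : int, `|p.[k%:~R]| <= B * r ^+ `|k|%N.
Proof.
move=> r1.
have /choice[b bP] : forall i : nat, exists B : R,
    0 <= B /\ forall n : nat, n%:R ^+ i <= B * r ^+ n.
  by move=> i; have [B B0 BP] := natX_le_geom i r1; exists B.
exists (\sum_(i < size p) `|p`_i| * b i).
  by apply: sumr_ge0 => i _; rewrite mulr_ge0//; have [] := bP i.
move=> k; rewrite horner_coef (le_trans (ler_norm_sum _ _ _))//.
rewrite mulr_suml; apply: ler_sum => i _; rewrite normrM -mulrA ler_wpM2l//.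
rewrite normrX -intr_norm -abszE.
by have [_] := bP i; apply.
Qed.

(** Termwise comparison with the exponential series.  It dominates the Taylor
    polynomials of the cosine by a function of slow exponential growth, uniformly
    in the degree. *)
Lemma cos_poly_bound (N : nat) (x : R) : `|series (cos_coeff x) N| <= expR `|x|.
Proof.
apply: (@le_trans _ _ (series (exp_coeff `|x|) N)).
  rewrite /series/= (le_trans (ler_norm_sum _ _ _))//.
  apply: ler_sum => i _; rewrite /cos_coeff /exp_coeff /=.
  rewrite !normrM normfV !normr_nat !normrX normrN normr1 expr1n mulr1.
  apply: ler_wpM2r; first by rewrite invr_ge0.
  by apply: ler_piMl; [exact: exprn_ge0|case: odd].
apply: nondecreasing_cvgn_le; last exact: is_cvg_series_exp_coeff.
apply/nondecreasing_seqP => n; rewrite !seriesEnat/= big_nat_recr//= lerDl.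
by rewrite /exp_coeff/= divr_ge0// exprn_ge0.
Qed.

Lemma cvg_cos_poly (x : R) : series (cos_coeff x) @ \oo --> cos x.
Proof. by rewrite unlock; exact: is_cvg_series_cos_coeff. Qed.

(** The Taylor polynomial of k |-> cos (tau (k - j)). *)
Definition cos_poly (tau j : R) (N : nat) : {poly R} :=
  \sum_(i < N) ((~~ odd i)%:R * (-1) ^+ i./2 / i`!%:R) *: (tau *: ('X - j%:P)) ^+ i.

Lemma horner_cos_poly tau j N x :
  (cos_poly tau j N).[x] = series (cos_coeff (tau * (x - j))) N.
Proof.
rewrite /cos_poly horner_sum seriesEord/=; apply: eq_bigr => i _.
rewrite hornerZ horner_exp hornerZ hornerXsubC /cos_coeff/=.
by rewrite -!mulrA; congr (_ * (_ * _)); rewrite mulrC.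
Qed.

Lemma cos_odd_pihalf (l : nat) : cos (pi / 2 * l.*2.+1%:R) = 0 :> R.
Proof.
elim: l => [|l IH]; first by rewrite mulr1 cos_pihalf.
have -> : pi / 2 * l.+1.*2.+1%:R = pi / 2 * l.*2.+1%:R + pi :> R.
  rewrite doubleS -[l.*2.+3]addn2 natrD mulrDr; congr (_ + _).
  by rewrite mulfVK.
by rewrite cosDpi IH oppr0.
Qed.

Lemma pow2_odd (m : nat) : (0 < m)%N -> exists i l, m = (2 ^ i * l.*2.+1)%N.
Proof.
elim/ltn_ind: m => m IH m0; have [om|em] := boolP (odd m).
  by exists 0%N, m./2; rewrite mul1n -[LHS]odd_double_half om.
have [||i [l e]] := IH m./2; [lia|lia|].
by exists i.+1, l; rewrite expnS -mulnA -e; lia.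
Qed.

Section Uniqueness.
Variables (u : int -> R) (s C : R).
Hypotheses (s0 : 0 < s) (s1 : s < 1) (hu : exp_decay u s C).

(* By [sr2], a test function may be multiplied twice by a function growing like
   [r ^+ `|k|] and its product with [u] still decays geometrically. *)
Let r := 1 + (1 - s) / 4.
Let r1 : 1 < r. Proof. by rewrite /r ltrDl divr_gt0// subr_gt0. Qed.
Let sr1 : s * r < 1.
Proof.
have [p0 p1] := (s0, s1).
have h : 0 < (1 - s) * (1 - s / 4) by rewrite mulr_gt0// ?subr_gt0//; lra.
by rewrite -subr_gt0 (_ : 1 - _ = (1 - s) * (1 - s / 4))// /r; field.
Qed.
Let sr2 : s * r * r < 1.
Proof.
have [p0 p1] := (s0, s1).
have h : 0 < (1 - s) * (1 - s / 2 - s * (1 - s) / 16).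
  by rewrite mulr_gt0// ?subr_gt0//; nra.
by rewrite -subr_gt0 (_ : 1 - _ = (1 - s) * (1 - s / 2 - s * (1 - s) / 16))// /r; field.
Qed.
Let r0 : 0 < r. Proof. exact: lt_trans r1. Qed.

(** The test functions whose products with all polynomials are annihilated by
    [u].  Closure under multiplication by polynomials is built in, because it is
    what lets Taylor polynomials of further factors be absorbed. *)
Definition null_against (phi : int -> R) := (forall k, `|phi k| <= 1) /\
  forall p : {poly R}, sumZ (fun k => p.[k%:~R] * phi k * u k) = 0.

Lemma bounded_poly_decay (phi : int -> R) (p : {poly R}) :
  (forall k, `|phi k| <= 1) ->
  exists B, exp_decay (fun k => p.[k%:~R] * phi k * u k) (s * r) B.
Proof.
move=> hphi; have [B B0 BP] := poly_le_geom p r1.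
exists (B * C) => k; rewrite !normrM.
rewrite [X in _ <= X](_ : _ = B * r ^+ `|k|%N * 1 * (C * s ^+ `|k|%N)).
  by rewrite ler_pM ?mulr_ge0// ler_pM.
by rewrite exprMn; ring.
Qed.

(** Taylor polynomials of the cosine are absorbed by the polynomial factor; they
    converge, dominated by [r ^+ `|k|], which the decay of [u] compensates as
    long as the frequency is at most [ln r]. *)
Lemma null_cos_small phi tau j : `|tau| <= ln r -> null_against phi ->
  null_against (fun k => cos (tau * (k%:~R - j%:~R)) * phi k).
Proof.
move=> htau [hphi nphi]; split.
  by move=> k; rewrite normrM -[1]mulr1 ler_pM// cos_max.
move=> p; have [B B0 BP] := poly_le_geom p r1.
have C0 := exp_decay_expr0 hu.
pose a_ N k := (p * cos_poly tau j%:~R N).[k%:~R] * phi k * u k.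
apply: (@sumZ_dominated _ a_ _ (s * r * r) (B * C * r ^+ `|j|%N)) => //.
- by rewrite !mulr_ge0// ltW.
- move=> N k; rewrite /a_ !normrM hornerM normrM horner_cos_poly.
  have h : `|series (cos_coeff (tau * (k%:~R - j%:~R))) N| <= r ^+ `|k|%N * r ^+ `|j|%N.
    apply: (le_trans (cos_poly_bound _ _)); rewrite -exprD.
    apply: (@le_trans _ _ (r ^+ `|k - j|%N)).
      have -> : r ^+ `|k - j|%N = expR (ln r * `|k - j|%N%:R).
        by rewrite expRM_natr lnK.
      rewrite ler_expR normrM ler_pM// -intrB -intr_norm -abszE.
      by [].
    by apply: ler_weXn2l; [exact: ltW|lia].
  rewrite [X in _ <= X](_ : _ = (B * r ^+ `|k|%N) * (r ^+ `|k|%N * r ^+ `|j|%N) * 1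
    * (C * s ^+ `|k|%N)); last by rewrite !exprMn; ring.
  by rewrite ler_pM ?mulr_ge0// ler_pM ?mulr_ge0// ler_pM.
- move=> k; rewrite /a_; apply: cvgMl; rewrite mulrA; apply: cvgMl.
  under eq_fun do rewrite hornerM horner_cos_poly.
  by apply: cvgMr; exact: cvg_cos_poly.
- by move=> N; exact: nphi.
Qed.

(** The formula cos (2 x) = 2 cos (x)^2 - 1 doubles the admissible frequency, so
    the restriction on [tau] disappears. *)
Lemma null_cos phi tau j : null_against phi ->
  null_against (fun k => cos (tau * (k%:~R - j%:~R)) * phi k).
Proof.
have [n] : exists n : nat, `|tau| <= 2 ^+ n * ln r.
  have lnr0 : 0 < ln r by rewrite ln_gt0.
  have := archi_boundP (divr_ge0 (normr_ge0 tau) (ltW lnr0)).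
  set n := Num.bound _; move=> hn; exists n.
  rewrite -ler_pdivrMr// (le_trans (ltW hn))// -natrX ler_nat.
  exact: ltnW (ltn_expl _ _).
elim: n tau phi => [|n IH] tau phi htau nphi.
  by apply: null_cos_small => //; rewrite expr0 mul1r in htau.
have htau2 : `|tau / 2| <= 2 ^+ n * ln r.
  by rewrite normrM normfV (ger0_norm (ler0n R 2)) ler_pdivrMr// mulrAC -exprSr.
have [b2 n2] := IH _ _ htau2 (IH _ _ htau2 nphi).
have [b0 n0] := nphi.
split; first by move=> k; rewrite normrM -[1]mulr1 ler_pM// cos_max.
move=> p.
rewrite (_ : (fun k => _) = fun k =>
   2 * (p.[k%:~R] * (cos (tau / 2 * (k%:~R - j%:~R))
         * (cos (tau / 2 * (k%:~R - j%:~R)) * phi k)) * u k)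
   + (-1) * (p.[k%:~R] * phi k * u k)); last first.
  apply/funext => k.
  have -> : tau * (k%:~R - j%:~R) = (tau / 2 * (k%:~R - j%:~R)) *+ 2.
    by rewrite -mulrnAl -[tau / 2 *+ 2]mulr_natr mulfVK.
  by rewrite cos_mulr2n; ring.
have [B2 d2] := bounded_poly_decay p b2.
have [B0 d0] := bounded_poly_decay p b0.
have sr0 : 0 <= s * r by rewrite mulr_ge0// ltW.
rewrite (sumZD sr0 sr1 (exp_decayM 2 d2) (exp_decayM (-1) d0)).
by rewrite (sumZM _ sr0 sr1 d2) (sumZM _ sr0 sr1 d0) n2 n0 !mulr0 addr0.
Qed.

Let delta (j : int) (N : nat) (k : int) : R :=
  \prod_(i < N) cos (pi / 2 ^+ i.+1 * (k%:~R - j%:~R)).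

Lemma delta_null j N : null_against (fun=> 1) -> null_against (delta j N).
Proof.
move=> n1; elim: N => [|N IH].
  by rewrite (_ : delta j 0 = fun=> 1)//; apply/funext => k; rewrite /delta big_ord0.
rewrite (_ : delta j N.+1 = fun k => cos (pi / 2 ^+ N.+1 * (k%:~R - j%:~R)) * delta j N k).
  exact: null_cos.
by apply/funext => k; rewrite /delta big_ord_recr/= mulrC.
Qed.

(** Write k - j = 2^i times an odd number: the factor of index [i] is then the
    cosine of an odd multiple of pi / 2. *)
Lemma delta_eq0 (j k : int) : k != j ->
  exists N0, forall N, (N0 <= N)%N -> delta j N k = 0.
Proof.
move=> kj; have [|i [l e]] := @pow2_odd `|k - j|%N; first by lia.
exists i.+1 => N iN; rewrite /delta (bigD1 (Ordinal iN))//=.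
have -> : cos (pi / 2 ^+ i.+1 * (k%:~R - j%:~R)) = 0 :> R; last by rewrite mul0r.
rewrite -cos_norm normrM -intrB -intr_norm -abszE e.
rewrite ger0_norm ?divr_ge0 ?pi_ge0 ?exprn_ge0//.
rewrite -(cos_odd_pihalf l); congr cos.
rewrite -[LHS]/(_ * (2 ^ i * l.*2.+1)%N%:R) natrM natrX exprS.
by field; rewrite expf_neq0.
Qed.

Definition moment (n : nat) : R := sumZ (fun k : int => k%:~R ^+ n * u k).

Lemma sumZ_poly (p : {poly R}) :
  sumZ (fun k : int => p.[k%:~R] * u k) = \sum_(i < size p) p`_i * moment i.
Proof.
have sr0 : 0 <= s * r by rewrite mulr_ge0// ltW.
have dec (p' : {poly R}) : exists B, exp_decay (fun k => p'.[k%:~R] * u k) (s * r) B.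
  have [|B] := @bounded_poly_decay (fun=> 1) p'; first by rewrite normr1.
  by under eq_fun do rewrite mulr1; exists B.
rewrite -{1}[p]coefK poly_def.
elim: (size p) => [|N IH].
  under eq_fun do rewrite big_ord0 horner0 mul0r.
  by rewrite big_ord0 (@sumZ_single _ _ 0).
rewrite (_ : (fun k => _) = fun k => (\sum_(i < N) p`_i *: 'X^i).[k%:~R] * u k
    + p`_N * (('X^N).[k%:~R] * u k)); last first.
  by apply/funext => k; rewrite big_ord_recr/= hornerD hornerZ; ring.
have [B1 d1] := dec (\sum_(i < N) p`_i *: 'X^i).
have [B2 d2] := dec 'X^N.
rewrite (sumZD sr0 sr1 d1 (exp_decayM p`_N d2)) IH (sumZM _ sr0 sr1 d2).
rewrite big_ord_recr/=; congr (_ + _ * _).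
by under eq_fun do rewrite hornerXn.
Qed.

(** If all moments vanish, the constant function [1] is a null test function,
    hence so are the products [delta j N], which tend to the indicator of [j]. *)
Lemma all_moments_eq0 : (forall n : nat, moment n = 0) ->
  forall j, u j = 0.
Proof.
move=> m0 j.
have sr0 : 0 <= s * r by rewrite mulr_ge0// ltW.
have b1 (k : int) : `|1 : R| <= 1 by rewrite normr1.
have n1 : null_against (fun=> 1).
  split=> // p; under eq_fun do rewrite mulr1.
  by rewrite sumZ_poly big1// => i _; rewrite m0 mulr0.
have [B d] : exists B, forall N,
    exp_decay (fun k => (1 : {poly R}).[k%:~R] * delta j N k * u k) (s * r) B.
  exists C => N k; have [bN _] := delta_null j N n1.
  rewrite hornerE mul1r normrM -[X in _ <= X]mul1r ler_pM//.
  rewrite (le_trans (hu k))// ler_wpM2l ?(exp_decay_expr0 hu)//.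
  by rewrite lerXn2r ?nnegrE// ?ltW// ltr_pMr.
pose a (k : int) : R := if k == j then u j else 0.
have aj : sumZ a = u j.
  rewrite (@sumZ_single _ _ j) /a ?eqxx// => k kj.
  by rewrite (negbTE kj).
rewrite -aj.
apply: (@sumZ_dominated _ _ a _ _ sr0 sr1 d) => [k|N]; last first.
  by have [_] := delta_null j N n1; apply.
rewrite /a; case: eqVneq => [->|kj].
  apply: cvg_near_cst; near=> N.
  rewrite hornerE mul1r /delta big1 ?mul1r// => i _.
  by rewrite subrr mulr0 cos0.
have [N0 h0] := delta_eq0 kj.
apply: cvg_near_cst; exists N0 => // N /= /h0 ->.
by rewrite mulr0 mul0r.
Unshelve. all: end_near. Qed.

Lemma first_nonzero_moment : (exists k, u k != 0) ->
  exists D, moment D != 0 /\ forall n, (n < D)%N -> moment n = 0.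
Proof.
move=> [k uk]; have ex : exists n, moment n != 0.
  apply: contrapT => /forallNP h; move: uk; rewrite all_moments_eq0 ?eqxx// => n.
  by apply/eqP; apply: contrapT => /negP; exact: h.
exists (ex_minn ex); case: ex_minnP => D mD min; split=> // n nD.
apply/eqP; apply: contraTT nD => mn; rewrite -leqNgt; exact: min.
Qed.

(** After the substitution k := x - k the weight is a polynomial of degree [D]
    in [k] with leading coefficient [(-1) ^+ D]; only its top moment survives. *)
Lemma convolution_pow (D : nat) (x : int) :
  (forall n, (n < D)%N -> moment n = 0) ->
  sumZ (fun k : int => k%:~R ^+ D * u (x - k)) = (-1) ^+ D * moment D.
Proof.
move=> h; rewrite -sumZ_opp.
pose p : {poly R} := (-1) ^+ D *: ('X - x%:~R%:P) ^+ D.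
have b1 (k : int) : `|1 : R| <= 1 by rewrite normr1.
have [B d] := bounded_poly_decay p b1.
have sr0 : 0 < s * r by rewrite mulr_gt0.
rewrite (_ : (fun k => _) = (fun k => p.[(k + x)%:~R] * 1 * u (k + x))); last first.
  apply/funext => k; rewrite opprK [x + k]addrC mulr1; congr (_ * _).
  rewrite /p hornerZ horner_exp hornerXsubC -exprMn; congr (_ ^+ _).
  by rewrite intrD rmorphN/=; ring.
rewrite (sumZ_shift x sr0 sr1 d); under eq_fun do rewrite mulr1.
rewrite sumZ_poly.
have sp : size p = D.+1 by rewrite size_scale ?signr_eq0// size_exp_XsubC.
rewrite sp big_ord_recr/= big1 ?add0r; last by move=> i _; rewrite h ?mulr0.
congr (_ * _); rewrite /p coefZ.
have /monicP := monic_exp D (monicXsubC (x%:~R : R)).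
by rewrite lead_coefE size_exp_XsubC => ->; rewrite mulr1.
Qed.

End Uniqueness.

Lemma absz_sub_ge (x L : nat) (k : int) :
  (x <= L)%N -> (`|k|%N - L <= `|x%:Z - k|%N)%N.
Proof. lia. Qed.

(** The distance from [k] to the box is j = |k| - L, and k^D s^j is at most
    L^D (j + 1)^D s^j; the polynomial in [j] is absorbed by weakening the rate
    from [s] to [q]. *)
Lemma window_decay (u : int -> R) (s C q : R) (D : nat) :
  0 < s -> s < q -> q < 1 -> 0 < C -> exp_decay u s C ->
  exists2 B, 0 < B & forall L x N : nat, (0 < L)%N -> (x <= L)%N -> (L <= N)%N ->
    `|sumZ (fun k : int => k%:~R ^+ D * u (x%:Z - k))
      - psumZ (fun k : int => k%:~R ^+ D * u (x%:Z - k)) N|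
    <= B * L%:R ^+ D * q ^+ (N.+1 - L).
Proof.
move=> s0 sq q1 C0 hu; have q0 : 0 < q by exact: lt_trans sq.
have qs1 : 1 < q / s by rewrite ltr_pdivlMr// mul1r.
have [B B0 BP] := natX_le_geom D qs1.
pose B' := B * (q / s) + 1.
have B'1 : 1 <= B' by rewrite /B' lerDr mulr_ge0// divr_ge0// ltW.
have B'0 : 0 < B' by exact: lt_le_trans B'1.
have q1' : 0 < 1 - q by rewrite subr_gt0.
exists (2 * (C * B') / (1 - q)); first by rewrite divr_gt0// !mulr_gt0.
move=> L x N L0 xL LN.
have L1 : (1 : R) <= L%:R by rewrite ler1n.
have LD0 : 0 < L%:R ^+ D :> R by rewrite exprn_gt0// (lt_le_trans ltr01).
have dec : exp_decay (fun k : int => k%:~R ^+ D * u (x%:Z - k)) q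
    (C * B' * L%:R ^+ D / q ^+ L).
  move=> k; rewrite normrM normrX -intr_norm -abszE.
  have uk := hu (x%:Z - k).
  have [kL|Lk] := leqP `|k|%N L.
    apply: (@le_trans _ _ (L%:R ^+ D * C)).
      rewrite ler_pM ?exprn_ge0//; first by rewrite lerXn2r ?nnegrE// ler_nat.
      rewrite (le_trans uk)// ler_piMr ?(ltW C0)//.
      by apply: exprn_ile1; apply: ltW => //; exact: lt_trans q1.
    rewrite [X in _ <= X](_ : _ = L%:R ^+ D * C * (B' * (q ^+ `|k|%N / q ^+ L))).
      rewrite ler_peMr ?mulr_ge0 ?(ltW LD0) ?(ltW C0)// mulr_ege1//.
      rewrite ler_pdivlMr ?exprn_gt0// mul1r.
      by apply: ler_wiXn2l => //; exact: ltW.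
    by ring.
  pose j := (`|k|%N - L)%N.
  have kE : `|k|%N = (L + j)%N by rewrite /j subnKC// ltnW.
  have h1 : (`|k|%N)%:R ^+ D <= L%:R ^+ D * j.+1%:R ^+ D :> R.
    rewrite -exprMn lerXn2r ?nnegrE// ?mulr_ge0// -natrM ler_nat kE mulnS leq_add2l.
    by rewrite leq_pmull.
  have h2 : j.+1%:R ^+ D * s ^+ j <= B' * q ^+ j.
    have := BP j.+1; rewrite exprSr expr_div_n => h.
    apply: (@le_trans _ _ (B * (q ^+ j / s ^+ j * (q / s)) * s ^+ j)).
      by rewrite ler_wpM2r// exprn_ge0// ltW.
    rewrite [X in X <= _](_ : _ = B * (q / s) * q ^+ j).
      by rewrite ler_wpM2r ?exprn_ge0 ?(ltW q0)// lerDl.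
    by field; rewrite expf_neq0 ?gt_eqF.
  have h3 : `|u (x%:Z - k)| <= C * s ^+ j.
    rewrite (le_trans uk)// ler_wpM2l ?(ltW C0)//.
    by apply: ler_wiXn2l; [exact: ltW|apply: ltW; exact: lt_trans q1|exact: absz_sub_ge].
  apply: (@le_trans _ _ ((L%:R ^+ D * j.+1%:R ^+ D) * (C * s ^+ j))).
    by rewrite ler_pM ?exprn_ge0.
  rewrite [X in X <= _](_ : _ = C * L%:R ^+ D * (j.+1%:R ^+ D * s ^+ j)); last by ring.
  rewrite [X in _ <= X](_ : _ = C * L%:R ^+ D * (B' * q ^+ j)).
    by rewrite ler_wpM2l// mulr_ge0// ltW.
  by rewrite kE exprD; field; rewrite expf_neq0// gt_eqF.
apply: (le_trans (sumZ_tail N (ltW q0) q1 dec)).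
rewrite le_eqVlt; apply/orP; left; apply/eqP.
rewrite -{1}(subnKC (leqW LN)) exprD.
by field; rewrite expf_neq0 ?gt_eqF.
Qed.

(** In [window_decay] take q = expR (- g) with D / beta <= g < |ln s|, which is
    possible exactly because D / |ln s| < beta.  Then L^D <= expR (g beta ln L),
    so the bound is at most a constant times expR (- g K). *)
Lemma window_lower_bound (u : int -> R) (s C beta c : R) (D : nat) :
  0 < s -> s < 1 -> 0 < C -> exp_decay u s C -> D%:R / `|ln s| < beta -> 0 < c ->
  exists2 K, 1 <= K & forall L x N : nat, (0 < L)%N -> (x <= L)%N ->
    L%:R + beta * ln L%:R + K <= N.+1%:R ->
    `|sumZ (fun k : int => k%:~R ^+ D * u (x%:Z - k))
      - psumZ (fun k : int => k%:~R ^+ D * u (x%:Z - k)) N| <= c.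
Proof.
move=> s0 s1 C0 hu hbeta c0.
have lns : ln s < 0 by rewrite ln_lt0// s0.
have beta0 : 0 < beta by apply: le_lt_trans hbeta; rewrite divr_ge0.
have Dbeta : D%:R / beta < - ln s.
  rewrite ltr_pdivrMr// mulrC -ltr_pdivrMr ?oppr_gt0//.
  by rewrite -(ltr0_norm lns).
pose g := (D%:R / beta - ln s) / 2.
have g1 : g < - ln s by rewrite /g; lra.
have Db0 : 0 <= D%:R / beta by rewrite divr_ge0// ltW.
have g0 : 0 < g by rewrite /g; lra.
have gb : D%:R <= g * beta by rewrite -ler_pdivrMr// /g; lra.
pose q := expR (- g).
have q0 : 0 < q by exact: expR_gt0.
have q1 : q < 1 by rewrite expR_lt1 oppr_lt0.
have sq : s < q by rewrite -[s]lnK ?posrE// ltr_expR; lra.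
have [B B0 BP] := window_decay D s0 sq q1 C0 hu.
(* This is the K for which B expR (- g K) <= c. *)
pose K := Num.max 1 (ln (B / c) / g).
exists K; first by rewrite le_max lexx.
move=> L x N L0 xL hN.
have L1 : (1 : R) <= L%:R by rewrite ler1n.
have lnL0 : 0 <= ln L%:R :> R by rewrite ln_ge0.
have K1 : 1 <= K by rewrite le_max lexx.
have LN : (L <= N)%N.
  rewrite -ltnS -(ltr_nat R); apply: lt_le_trans hN.
  by have := mulr_ge0 (ltW beta0) lnL0; lra.
apply: (le_trans (BP L x N L0 xL LN)).
have -> : q ^+ (N.+1 - L) = expR (- g * (N.+1%:R - L%:R)).
  by rewrite -natrB ?(leqW LN)// expRM_natr.
have -> : L%:R ^+ D = expR (ln L%:R * D%:R) :> R.
  by rewrite expRM_natr lnK// posrE; lra.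
rewrite -mulrA -expRD -ler_pdivlMl// [B^-1 * c]mulrC.
have -> : c / B = expR (- ln (B / c)).
  by rewrite expRN lnK ?posrE ?divr_gt0// invf_div.
rewrite ler_expR.
have hK : ln (B / c) <= g * K.
  by rewrite [g * K]mulrC -ler_pdivrMr// /K le_max lexx orbT.
have h1 : g * (beta * ln L%:R + K) <= g * (N.+1%:R - L%:R).
  by rewrite ler_pM2l//; lra.
have h2 : ln L%:R * D%:R <= ln L%:R * (g * beta) by rewrite ler_wpM2l.
lra.
Qed.
End Moments.

(** * Eigenvalue counting for Hermitian matrices *)

Section HermitianCounting.
Local Open Scope complex_scope.

Local Notation "M ^t*" := (map_mx Num.conj (trmx M)) (at level 30).

Definition eigenvalue_count (R : realType) n (A : 'M[R[i]]_n) (lam : R) : nat :=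
  #|[pred i | complex.Re (spectral_diag A 0 i) <= lam]|.

Lemma trace_spectral_projectionE (R : realType) n (A : 'M[R[i]]_n) (I : set R) :
  trace_spectral_projection I A
  = \sum_i (\1_I (complex.Re (spectral_diag A 0 i)) : R).
Proof.
rewrite /trace_spectral_projection /spectral_calculus mxtrace_mulC mulmxA.
rewrite mulmxV ?spectral_unit// mul1mx mxtrace_diag raddf_sum /=.
by apply: eq_bigr => i _; rewrite mxE.
Qed.

Definition qform (R : realType) n (A : 'M[R[i]]_n) (v : 'rV[R[i]]_n) : R[i] :=
  (v *m A *m v^t*) 0 0.

(** In the coordinates of an eigenbasis the form is diagonal. *)
Lemma qform_spectral (R : realType) n (A : 'M[R[i]]_n) (v : 'rV[R[i]]_n) :
  A \is hermsymmx ->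
  qform A v = \sum_i spectral_diag A 0 i * `|(v *m (spectralmx A)^t*) 0 i| ^+ 2.
Proof.
move=> Ah; rewrite /qform.
have /hermitian_normalmx /orthomx_spectralP Aeq := Ah.
rewrite {1}Aeq invmx_unitary ?spectral_unitarymx//.
set P := spectralmx A; set w := v *m P^t*.
have -> : v *m (P^t* *m diag_mx (spectral_diag A) *m P) *m v^t*
    = w *m diag_mx (spectral_diag A) *m w^t*.
  rewrite /w trmx_mul map_mxM trmxCK.
  by rewrite !mulmxA.
rewrite mxE; apply: eq_bigr => i _; rewrite mul_mx_diag !mxE normCK.
by rewrite mulrAC mulrA mulrC mulrA.
Qed.

Lemma qform1_unitary (R : realType) n (P : 'M[R[i]]_n) (v : 'rV[R[i]]_n) :
  P \is unitarymx -> qform 1%:M v = \sum_i `|(v *m P^t*) 0 i| ^+ 2.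
Proof.
move=> Pu; rewrite /qform mulmx1.
have -> : v *m v^t* = (v *m P^t*) *m (v *m P^t*)^t*.
  by rewrite trmx_mul map_mxM trmxCK !mulmxA mulmxKtV.
by rewrite mxE; apply: eq_bigr => i _; rewrite !mxE normCK.
Qed.

Definition rows_where (R : realType) n (S : pred 'I_n) (P : 'M[R[i]]_n) :
    'M[R[i]]_(#|S|, n) := rowsub (fun k => enum_val k) P.

Lemma rank_rows_where (R : realType) n (S : pred 'I_n) (P : 'M[R[i]]_n) :
  P \is unitarymx -> \rank (rows_where S P) = #|S|.
Proof.
move=> Pu; apply: mxrank_unitary; apply/unitarymxP/matrixP => i j.
have /unitarymxP/matrixP/(_ (enum_val i) (enum_val j)) := Pu.
rewrite !mxE (inj_eq enum_val_inj) => <-.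
by apply: eq_bigr => k _; rewrite !mxE.
Qed.

Lemma rows_where_coord (R : realType) n (S : pred 'I_n) (P : 'M[R[i]]_n)
    (v : 'rV[R[i]]_n) (i : 'I_n) :
  P \is unitarymx -> (v <= rows_where S P)%MS -> i \notin S ->
  (v *m P^t*) 0 i = 0.
Proof.
move=> Pu /submxP[x ->] iS.
have -> : x *m rows_where S P *m P^t* = x *m rows_where S 1%:M.
  by rewrite -mulmxA /rows_where mul_rowsub_mx; move/unitarymxP: Pu => ->.
rewrite mxE big1// => k _; rewrite !mxE.
case: eqP => [e|]; last by rewrite mulr0.
by move: iS; rewrite -e enum_valP.
Qed.

Lemma real_spectral_diag (R : realType) n (A : 'M[R[i]]_n) i :
  A \is hermsymmx ->
  spectral_diag A 0 i = (complex.Re (spectral_diag A 0 i))%:C.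
Proof.
move=> /hermitian_spectral_diag_real /mxOverP/(_ 0 i).
by move=> /Creal_ReP; rewrite -complexRe => ->.
Qed.

(** Min-max by dimension count.  If [B] had more eigenvalues below [b] than [A]
    has below [a], the span of the corresponding eigenvectors of [B] would meet
    the span of the eigenvectors of [A] with eigenvalues above [a], because the
    dimensions add up to more than [n].  A nonzero common vector contradicts the
    comparison of the forms. *)
Lemma eigenvalue_count_le (R : realType) n (A B : 'M[R[i]]_n) (a b : R) :
  A \is hermsymmx -> B \is hermsymmx ->
  (forall v, qform B v <= b%:C * qform 1%:M v ->
             qform A v <= a%:C * qform 1%:M v) ->
  (eigenvalue_count B b <= eigenvalue_count A a)%N.
Proof.
move=> Ah Bh AB; rewrite leqNgt; apply/negP => ltAB.
pose S := [pred i | complex.Re (spectral_diag B 0 i) <= b].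
pose T := [predC [pred i | complex.Re (spectral_diag A 0 i) <= a]].
have cT : (eigenvalue_count A a + #|T| = n)%N.
  by rewrite /eigenvalue_count cardC card_ord.
set U := rows_where S (spectralmx B); set W := rows_where T (spectralmx A).
have := mxrank_sum_cap U W.
rewrite !rank_rows_where ?spectral_unitarymx// => rk.
have : (0 < \rank (U :&: W)%MS)%N.
  rewrite lt0n; apply/eqP => r0; move: rk; rewrite r0 addn0.
  have := rank_leq_col (U + W)%MS => + rk; rewrite rk => le_n.
  have : (#|S| + #|T| <= eigenvalue_count A a + #|T|)%N by rewrite cT.
  by rewrite leq_add2r leqNgt => /negP; apply.
rewrite lt0n mxrank_eq0 => /rowV0Pn[v]; rewrite sub_capmx => /andP[vU vW] v0.
have : qform B v <= b%:C * qform 1%:M v.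
  rewrite qform_spectral// (@qform1_unitary _ _ (spectralmx B))
    ?spectral_unitarymx//.
  rewrite mulr_sumr; apply: ler_sum => i _.
  have [iS|iS] := boolP (i \in S).
    apply: ler_wpM2r; first by rewrite exprn_ge0.
    by rewrite real_spectral_diag// lecR; exact: iS.
  by rewrite (rows_where_coord _ vU iS) ?spectral_unitarymx// normr0 expr0n/= !mulr0.
move/AB; rewrite qform_spectral// (@qform1_unitary _ _ (spectralmx A))
    ?spectral_unitarymx//.
have real_summand (x : R) (z : R[i]) : x%:C * `|z| ^+ 2 \is Num.real.
  by rewrite rpredM ?rpredX ?normr_real//; apply/complex_realP; exists x.
apply/negP; rewrite -real_ltNge; first last.
- by apply: rpred_sum => i _; rewrite real_spectral_diag.
- by rewrite mulr_sumr; apply: rpred_sum => i _.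
rewrite mulr_sumr.
set w := v *m (spectralmx A)^t*.
have [i wi] : exists i, w 0 i != 0.
  apply/existsP; apply: contraNT v0; rewrite negb_exists => /forallP w0.
  have w00 : w = 0.
    by apply/rowP => i; rewrite [RHS]mxE; apply/eqP; move: (w0 i); rewrite negbK.
  apply/eqP; rewrite -[v](@mulmxKtV _ _ _ _ _ (spectralmx A)) ?spectral_unitarymx//.
  by rewrite -/w w00 mul0mx.
have mono j : a%:C * `|w 0 j| ^+ 2 <= spectral_diag A 0 j * `|w 0 j| ^+ 2
   ?= iff (w 0 j == 0).
  have [jT|jT] := boolP (j \in T); last first.
    rewrite /w (rows_where_coord _ vW jT) ?spectral_unitarymx// normr0 expr0n/= !mulr0.
    by rewrite eqxx; apply/leifP.
  apply/leifP; case: eqP => [->|/eqP w0]; first by rewrite normr0 expr0n/= !mulr0.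
  rewrite ltr_pM2r ?exprn_gt0 ?normr_gt0// real_spectral_diag// ltcR ltNge.
  exact: jT.
rewrite lt_neqAle; have [-> ->] := leif_sum (fun j (_ : true) => mono j).
by rewrite andbT; apply/forall_inP => /(_ i isT); rewrite (negbTE wi).
Qed.

Section DiagonalPerturbation.
Variables (R : realType) (n : nat) (M : 'M[R[i]]_n).
Hypothesis Mh : M \is hermsymmx.

Definition diag_pert (v : 'I_n -> R) : 'M[R[i]]_n :=
  M + diag_mx (\row_i (v i)%:C).

Lemma hermsym_diag_pert v : diag_pert v \is hermsymmx.
Proof.
apply/is_hermitianmxP; rewrite expr0 scale1r; apply/matrixP => i j.
move/is_hermitianmxP: Mh; rewrite expr0 scale1r => /matrixP/(_ i j).
rewrite !mxE => ->; rewrite rmorphD/=; congr (_ + _).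
rewrite rmorphMn eq_sym; case: eqP => [->|]; last by rewrite !mulr0n.
by congr (_ *+ _); apply/esym/conj_Creal/complex_realP; exists (v i).
Qed.

Lemma qform_diag_pert v w :
  qform (diag_pert v) w = qform M w + \sum_i (v i)%:C * `|w 0 i| ^+ 2.
Proof.
rewrite /qform mulmxDr mulmxDl mxE; congr (_ + _).
rewrite mul_mx_diag mxE; apply: eq_bigr => i _; rewrite !mxE normCK.
by rewrite mulrAC mulrC.
Qed.

Lemma qform1E (w : 'rV[R[i]]_n) : qform 1%:M w = \sum_i `|w 0 i| ^+ 2.
Proof.
by rewrite /qform mulmx1 mxE; apply: eq_bigr => i _; rewrite !mxE normCK.
Qed.

(** Lowering the diagonal by at most [kappa] lowers the eigenvalues by at most
    [kappa]. *)
Lemma eigenvalue_count_shift (v v' : 'I_n -> R) (kappa lam : R) :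
  (forall i, v i <= v' i + kappa) ->
  (eigenvalue_count (diag_pert v') lam
     <= eigenvalue_count (diag_pert v) (lam + kappa))%N.
Proof.
move=> vv'; apply: eigenvalue_count_le; rewrite ?hermsym_diag_pert// => w.
rewrite !qform_diag_pert raddfD/= mulrDl => h.
have : qform M w + \sum_i (v i)%:C * `|w 0 i| ^+ 2 <=
  (qform M w + \sum_i (v' i)%:C * `|w 0 i| ^+ 2) + kappa%:C * qform 1%:M w.
  rewrite -addrA lerD2l qform1E mulr_sumr -big_split/=.
  apply: ler_sum => i _; rewrite -mulrDl -raddfD/=.
  by apply: ler_wpM2r; rewrite ?exprn_ge0// lecR.
by move/le_trans; apply; rewrite lerD2r.
Qed.

End DiagonalPerturbation.

(** The auxiliary level [a'] strictly below [a] accounts for the interval being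
    closed: an eigenvalue equal to [a] must not be subtracted. *)
Lemma trace_interval_le (R : realType) n (A : 'M[R[i]]_n) (a b a' : R) :
  a' < a -> a <= b ->
  trace_spectral_projection [set x : R | a <= x <= b] A
    <= (eigenvalue_count A b)%:R - (eigenvalue_count A a')%:R.
Proof.
move=> a'a ab; rewrite trace_spectral_projectionE /eigenvalue_count.
rewrite -!sum1_card !natr_sum [X in _ <= X - _]big_mkcond [X in _ <= _ - X]big_mkcond/=.
rewrite -sumrB; apply: ler_sum => i _; rewrite indicE !inE.
set x := complex.Re _.
have [xa'|xa'] := leP x a'.
  rewrite memNset/=; last first.
    by move=> /= /andP[ax xb]; move: (lt_le_trans a'a ax); rewrite ltNge xa'.
  by rewrite (le_trans xa' (le_trans (ltW a'a) ab)) subrr.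
rewrite subr0; have [xI|xI] := boolP (x \in [set x : R | a <= x <= b]).
  by move: xI; rewrite inE/= => /andP[_ ->].
by case: ifP.
Qed.

Lemma trace_spectral_projection_ge0 (R : realType) n (A : 'M[R[i]]_n) (I : set R) :
  0 <= trace_spectral_projection I A.
Proof. by rewrite trace_spectral_projectionE sumr_ge0. Qed.

Lemma trace_spectral_projection_le (R : realType) n (A : 'M[R[i]]_n) (I : set R) :
  trace_spectral_projection I A <= n%:R.
Proof.
rewrite trace_spectral_projectionE -[X in _ <= X%:R](card_ord n) -sum1_card natr_sum.
by apply: ler_sum => i _; rewrite indicE; case: (_ \in _).
Qed.

Lemma eigenvalue_count_le_size (R : realType) n (A : 'M[R[i]]_n) lam :
  (eigenvalue_count A lam <= n)%N.
Proof. by rewrite -[X in (_ <= X)%N](card_ord n) max_card. Qed.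

End HermitianCounting.

(** * Means over a product grid *)

Section GridMean.
Variables (R : realType) (N Q : nat) (p : 'I_Q.+2 -> R) (x0 h : R).
Hypothesis p_ge0 : forall i, 0 <= p i.
Hypothesis p_sum : \sum_i p i <= 1.
Hypothesis p_max : p ord_max = 0.

Definition grid_point (i : 'I_Q.+2) : R := x0 + h * i%:R.

Definition grid_vector (iota : {ffun 'I_N -> 'I_Q.+2}) : 'rV[R]_N :=
  \row_j grid_point (iota j).

(** The mean of [G] over independent coordinates with law
    [\sum_i p i * dirac (grid_point i)].  Indices form a cyclic group so that
    shifting one coordinate by one step is a bijection of the multi-indices. *)
Definition grid_mean (G : 'rV[R]_N -> R) : R :=
  \sum_(iota : {ffun 'I_N -> 'I_Q.+2}) (\prod_j p (iota j)) * G (grid_vector iota).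

Definition cyclic_variation : R := \sum_i `|p i - p (i - 1)|.

Lemma cyclic_variation_ge0 : 0 <= cyclic_variation.
Proof. exact: sumr_ge0. Qed.

Let unit_shift (k : 'I_N) : {ffun 'I_N -> 'I_Q.+2} :=
  [ffun j => if j == k then 1 else 0].

Lemma grid_vector_shift k (iota : {ffun 'I_N -> 'I_Q.+2}) : iota k != ord_max ->
  grid_vector (iota + unit_shift k) = grid_vector iota + h *: delta_mx 0 k.
Proof.
move=> ik; apply/rowP => j; rewrite !mxE !ffunE eqxx/=.
case: eqVneq => [->|_]; last by rewrite addr0 mulr0 addr0.
rewrite /grid_point mulr1 -addrA; congr (_ + _); rewrite -[X in _ = _ + X](mulr1 h) -mulrDr.
congr (_ * _); rewrite natr1; congr (_%:R).
have ltk : (iota k < Q.+1)%N.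
  have := ltn_ord (iota k); rewrite ltnS leq_eqVlt.
  by rewrite -[X in _ == X]/(val (@ord_max Q.+1)) val_eqE (negbTE ik).
by rewrite /= [(1 %% _)%N]modn_small// addn1 modn_small.
Qed.

(** Summation by parts: reindexing by the cyclic shift of coordinate [k] moves
    the shift from [G] to the weights.  The wrap-around does no harm because
    [p ord_max = 0].  The remaining sum is a product over the coordinates, the
    variation of [p] for [k] and a total mass at most [1] for the others. *)
Lemma grid_mean_step_up (G : 'rV[R]_N -> R) (M : R) k :
  (forall y, 0 <= G y) -> (forall y, G y <= M) ->
  grid_mean G - grid_mean (fun y => G (y + h *: delta_mx 0 k))
    <= M * cyclic_variation.
Proof.
move=> G0 GM; have M0 : 0 <= M by exact: le_trans (G0 0) (GM 0).
pose mu (iota : {ffun 'I_N -> 'I_Q.+2}) := \prod_j p (iota j).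
have -> : grid_mean (fun y => G (y + h *: delta_mx 0 k)) =
    \sum_(iota : {ffun 'I_N -> 'I_Q.+2}) mu (iota - unit_shift k) * G (grid_vector iota).
  rewrite [RHS](reindex_inj (addIr (unit_shift k))); apply: eq_bigr => iota _.
  rewrite addrK -/(mu iota).
  have [ik|ik] := eqVneq (iota k) ord_max; last by rewrite grid_vector_shift.
  by rewrite /mu (bigD1 k)//= ik p_max !mul0r.
rewrite /grid_mean -sumrB.
pose q j i := if j == k then `|p i - p (i - 1)| else p i.
apply: (@le_trans _ _ (\sum_(iota : {ffun 'I_N -> 'I_Q.+2}) M * \prod_j q j (iota j))).
  apply: ler_sum => iota _; rewrite -/(mu iota) -mulrBl.
  apply: (@le_trans _ _ (`|mu iota - mu (iota - unit_shift k)| * G (grid_vector iota))).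
    by rewrite ler_wpM2r// ler_norm.
  rewrite mulrC ler_pM//.
  rewrite /mu (bigD1 k)//= [X in _ - X](bigD1 k)//= [X in _ <= X](bigD1 k)//=.
  rewrite !ffunE eqxx/= /q eqxx.
  rewrite [X in _ - _ * X](eq_bigr (fun j => p (iota j))) => [|j /negbTE jk]; last first.
    by rewrite !ffunE jk subr0.
  rewrite -mulrBl normrM [X in _ <= _ * X](eq_bigr (fun j => p (iota j))); last first.
    by move=> j /negbTE ->.
  by rewrite [X in _ * X]ger0_norm// prodr_ge0.
rewrite -mulr_sumr -(bigA_distr_bigA (fun j i => q j i))/= (bigD1 k)//=.
rewrite ler_wpM2l// /q eqxx -[X in _ <= X]mulr1 ler_pM ?cyclic_variation_ge0//.
  by apply: prodr_ge0 => j /negbTE ->; exact: sumr_ge0.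
apply: prodr_ile1 => j /negbTE -> /=; rewrite p_sum andbT; exact: sumr_ge0.
Qed.

(** Apply [grid_mean_step_up] to the function y |-> M - G (y - h e_k). *)
Lemma grid_mean_step_down (G : 'rV[R]_N -> R) (M : R) k :
  (forall y, 0 <= G y) -> (forall y, G y <= M) ->
  grid_mean G - grid_mean (fun y => G (y - h *: delta_mx 0 k))
    <= M * cyclic_variation.
Proof.
move=> G0 GM.
have G'0 y : 0 <= M - G (y - h *: delta_mx 0 k) by rewrite subr_ge0.
have G'M y : M - G (y - h *: delta_mx 0 k) <= M by rewrite gerBl.
apply: le_trans (grid_mean_step_up k G'0 G'M).
rewrite /grid_mean -!sumrB; apply: ler_sum => iota _.
by rewrite addrK; lra.
Qed.

(** A lattice shift is a succession of [\sum_j `|z j|] unit steps, and each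
    intermediate translate of [G] has the same bounds as [G]. *)
Lemma grid_mean_shift (z : 'I_N -> int) (G : 'rV[R]_N -> R) (M : R) :
  (forall y, 0 <= G y) -> (forall y, G y <= M) ->
  grid_mean G - grid_mean (fun y => G (y + \row_j (h * (z j)%:~R)))
    <= M * cyclic_variation * (\sum_j `|z j|%N)%:R.
Proof.
have [n] := ubnP (\sum_j `|z j|%N); elim: n z => // n IH z zn G0 GM.
have [/forallP z0|] := boolP [forall j, z j == 0].
  have -> : \row_j (h * (z j)%:~R) = 0 :> 'rV[R]_N.
    by apply/rowP => j; rewrite !mxE (eqP (z0 j)) mulr0.
  under [X in _ - grid_mean X]eq_fun do rewrite addr0.
  rewrite subrr !mulr_ge0// ?cyclic_variation_ge0//.
  exact: le_trans (G0 0) (GM 0).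
rewrite negb_forall => /existsP[k zk].
pose z' j := if j == k then z k - sgz (z k) else z j.
have zz' : (\sum_j `|z j|%N = (\sum_j `|z' j|%N).+1)%N.
  rewrite (bigD1 k)//= [in RHS](bigD1 k)//= {1}/z' eqxx -addSn; congr (_ + _)%N.
    by move: zk; case: (sgzP (z k)) => // zk _; lia.
  by apply: eq_bigr => j /negbTE jk; rewrite /z' jk.
have rowE : \row_j (h * (z j)%:~R) =
    \row_j (h * (z' j)%:~R) + (sgz (z k))%:~R *: (h *: delta_mx 0 k) :> 'rV[R]_N.
  apply/rowP => j; rewrite !mxE eqxx/= /z'; case: eqVneq => [->|_].
    by rewrite intrB mulr1; ring.
  by rewrite !mulr0 addr0.
set w := \row_j (h * (z' j)%:~R) in rowE.
have step : grid_mean (fun y => G (y + w))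
   - grid_mean (fun y => G (y + \row_j (h * (z j)%:~R))) <= M * cyclic_variation.
  rewrite rowE.
  have := grid_mean_step_up k (G := fun y => G (y + w)) (M := M).
  have := grid_mean_step_down k (G := fun y => G (y + w)) (M := M).
  move=> /(_ (fun=> G0 _) (fun=> GM _)) down /(_ (fun=> G0 _) (fun=> GM _)) up.
  case: (sgzP (z k)) zk => // _ _.
    rewrite [X in _ - grid_mean X](_ : _ = fun y => G (y + h *: delta_mx 0 k + w))//.
    by apply/funext => y; congr G; rewrite scale1r addrA addrAC.
  rewrite [X in _ - grid_mean X](_ : _ = fun y => G (y - h *: delta_mx 0 k + w))//.
  by apply/funext => y; congr G; rewrite scaleN1r addrA addrAC.
have := IH z' _ G0 GM; rewrite -ltnS -zz' zn => /(_ isT) IH'.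
rewrite zz' -natr1 mulrDr mulr1.
have := lerD IH' step; rewrite -/w.
by apply: le_trans; rewrite addrA subrK.
Qed.

End GridMean.

(** * Cell masses of a density of bounded variation *)

Section Translation.
Variable R : realType.
Local Notation mu := (@lebesgue_measure R).

(** It suffices to compare the two measures on bounded half-open intervals. *)
Lemma lebesgue_measure_translate (c : R) (A : set R) : measurable A ->
  pushforward mu ((fun x => c + x) : _ -> measurableTypeR R) A = mu A.
Proof.
have mc : measurable_fun setT ((fun x => c + x) : measurableTypeR R -> measurableTypeR R).
  by apply: measurable_funD => //; exact: measurable_cst.
move=> mA; apply/esym.
have @phi : {mfun measurableTypeR R >-> measurableTypeR R} :=
  HB.pack (fun x : measurableTypeR R => c + x) (isMeasurableFun.Build _ _ _ _ _ mc).
apply: (@lebesgue_measure_unique R (pushforward mu phi)) => //= _ [[a b]] _ <-.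
rewrite /pushforward/=.
have -> : phi @^-1` `]a, b] = `]a - c, b - c]%classic.
  apply/seteqP; split => x/=; rewrite !in_itv/= => /andP[h1 h2]; apply/andP; split; lra.
rewrite !lebesgue_measure_itv/=.
by rewrite !lte_fin ltrD2r -!EFinB; case: ifP => // _; congr EFin; ring.
Qed.

Lemma integral_translate (f : R -> \bar R) (a h : R) :
  measurable_fun setT f -> (forall x, 0 <= f x)%E ->
  (\int[mu]_(x in `[a, (a + h)%R[) f x = \int[mu]_(x in `[0%R, h[) f (a + x)%R)%E.
Proof.
move=> mf f0.
have mc : measurable_fun setT ((fun x => a + x) : measurableTypeR R -> measurableTypeR R).
  by apply: measurable_funD => //; exact: measurable_cst.
have -> : `[0%R, h[%classic = (fun x => a + x) @^-1` `[a, a + h[%classic.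
  apply/seteqP; split => x/=; rewrite !in_itv/= => /andP[h1 h2]; apply/andP; split; lra.
rewrite -(ge0_integral_pushforward mc mu (D := `[a, a + h[%classic)) => //.
  apply: eq_measure_integral => A mA _.
  exact: esym (lebesgue_measure_translate a mA).
exact: measurable_funTS.
Qed.

Lemma sum_dist_le_total_variation (f : R -> R) (a h : R) n : 0 <= h ->
  (\sum_(i < n) `|f (a + h * i.+1%:R) - f (a + h * i%:R)|%:E
    <= total_variation a (a + h * n%:R) f)%E.
Proof.
move=> h0; elim: n => [|n IH].
  by rewrite big_ord0 mulr0 addr0 total_variation_ge0.
rewrite big_ord_recr/= (@total_variationD _ a _ (a + h * n%:R)).
- apply: leeD => //; apply: total_variation_ge.
  by rewrite lerD2l ler_wpM2l// ler_nat.
- by rewrite lerDl mulr_ge0.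
- by rewrite lerD2l ler_wpM2l// ler_nat.
Qed.

Lemma total_variation_le_BVnorm (f : R -> R) (a b : R) : in_BV f -> a <= b ->
  (total_variation a b f <= (BVnorm f)%:E)%E.
Proof.
move=> bv ab; have tv0 : (0 <= total_variationR f)%E.
  apply: (@le_trans _ _ (total_variation a b f)); first exact: total_variation_ge0.
  by apply: ereal_sup_ubound; exists (a, b).
rewrite /BVnorm fineK; first by apply: ereal_sup_ubound; exists (a, b).
by rewrite ge0_fin_numE.
Qed.

Lemma BVnorm_ge0 (f : R -> R) : in_BV f -> 0 <= BVnorm f.
Proof.
move=> bv; rewrite -lee_fin; apply: le_trans (total_variation_le_BVnorm bv (lexx 0)).
exact: total_variation_ge0.
Qed.

Definition cell_mass (f : R -> R) (a h : R) (i : nat) : R :=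
  fine (\int[mu]_(x in `[(a + h * i%:R)%R, (a + h * i.+1%:R)%R[) (f x)%:E)%E.

(** After translation all cells become [0, h[, and the sum of the increments is
    at most the integral over [0, h[ of the variation of [f] along an arithmetic
    progression of step [h]. *)
Lemma cell_increment_sum (f : R -> R) (a h : R) n : 0 <= h ->
  measurable_fun setT f -> (forall x, 0 <= f x) -> in_BV f ->
  (\int[mu]_x (f x)%:E < +oo)%E ->
  \sum_(i < n) `|cell_mass f a h i.+1 - cell_mass f a h i| <= h * BVnorm f.
Proof.
move=> h0 mf f0 bv fint.
have mEf : measurable_fun setT (EFin \o f) by exact/measurable_EFinP.
pose g i x := f (a + h * i%:R + x).
have mg i : measurable_fun setT (g i).
  apply: measurableT_comp => //.
  by apply: measurable_funD => //; exact: measurable_cst.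
have FE i : cell_mass f a h i = fine (\int[mu]_(x in `[0%R, h[) (g i x)%:E)%E.
  rewrite /cell_mass; congr fine; rewrite -(integral_translate (f := EFin \o f))//.
  by rewrite -natr1 mulrDr mulr1 addrA.
have mgd i : measurable_fun setT (g i.+1 \- g i).
  by apply: measurable_funB; exact: mg.
have ig i : mu.-integrable `[0, h[ (EFin \o g i).
  apply/integrableP; split; first by apply/measurable_EFinP; apply: measurable_funTS; exact: mg.
  rewrite [X in (X < _)%E](_ : _ = (\int[mu]_(x in `[0%R, h[) (g i x)%:E)%E); last first.
    by apply: eq_integral => x _ /=; rewrite ger0_norm// /g.
  rewrite -(integral_translate (f := EFin \o f)) => [|//|x]; last by rewrite lee_fin.
  apply: le_lt_trans fint; apply: ge0_subset_integral => // x _; rewrite lee_fin//.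
rewrite -lee_fin EFinM -sumEFin.
apply: (@le_trans _ _ (\int[mu]_(x in `[0%R, h[) \sum_(i < n) `|g i.+1 x - g i x|%:E)%E).
  rewrite ge0_integral_sum//; last first.
    move=> i; apply/measurable_EFinP; apply: measurable_funTS.
    by apply: measurableT_comp => //; exact: mgd.
  apply: lee_sum => i _; rewrite !FE.
  have fing j : (\int[mu]_(x in `[0%R, h[) (g j x)%:E)%E \is a fin_num.
    exact: integrable_fin_num (ig j).
  rewrite -abse_EFin EFinB !(fineK (fing _)).
  rewrite -(integralB_EFin _ (ig i.+1) (ig i))//.
  have := @le_abse_integral _ _ _ mu `[0, h[%classic (EFin \o (g i.+1 \- g i)).
  apply => //; apply/measurable_EFinP; apply: measurable_funTS.
  exact: mgd.
apply: (@le_trans _ _ (\int[mu]_(x in `[0%R, h[) (cst (BVnorm f)%:E x))%E).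
  apply: ge0_le_integral => //.
  - by move=> x _; exact: sume_ge0.
  - apply: emeasurable_sum => i; apply/measurable_EFinP; apply: measurable_funTS.
    by apply: measurableT_comp => //; exact: mgd.
  - move=> x _ /=.
    rewrite (eq_bigr (fun i : 'I_n =>
      `|f ((a + x) + h * i.+1%:R) - f ((a + x) + h * i%:R)|%:E)).
      apply: le_trans (sum_dist_le_total_variation f (a + x) n h0) _.
      by apply: total_variation_le_BVnorm => //; rewrite lerDl mulr_ge0.
    by move=> i _; rewrite /g addrAC [X in _ - f X]addrAC.
rewrite integral_cst//= lebesgue_measure_itv/= lte_fin.
case: ltP => [_|_]; rewrite ?sube0 ?oppr0 ?adde0 muleC// mul0e mule_ge0//.
by rewrite lee_fin BVnorm_ge0.
Qed.

End Translation.

(** * Rounding independent random variables to a grid *)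

Section Expectation.
Context {R : realType} {d : measure_display} {T : measurableType d}.
Variable P : probability T R.

(** The integral of a nonnegative function is the supremum of the integrals of
    the simple functions below it, whether or not [g] is measurable. *)
Lemma expectation_monotone (g : T -> R) (G : T -> \bar R) :
  (forall w, 0 <= g w) -> (forall w, (g w)%:E <= G w)%E ->
  ('E_P[g] <= \int[P]_w G w)%E.
Proof.
move=> g0 gG; rewrite unlock ge0_integralTE; last by move=> w; rewrite lee_fin.
rewrite ge0_integralTE; last first.
  by move=> w; apply: le_trans (gG w); rewrite lee_fin.
apply: ereal_sup_le => _ [k kg <-]; exists k => // w.
exact: le_trans (kg w) (gG w).
Qed.

(** On a measurable null set containing [N0] the function [g] is dominated by
    [B] times an indicator, which contributes nothing to the integral. *)
Lemma expectation_le_simple (I : finType) (g : T -> R) (B : R) (c : I -> R)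
    (A : I -> set T) (N0 : set T) :
  (forall w, 0 <= g w) -> (forall w, g w <= B) -> (forall i, 0 <= c i) ->
  (forall i, measurable (A i)) -> P.-negligible N0 ->
  (forall w, ~ N0 w -> exists2 i, A i w & g w <= c i) ->
  ('E_P[g] <= \sum_i (c i)%:E * P (A i))%E.
Proof.
move=> g0 gB c0 mA [N [mN PN N0N]] gc.
pose G w := (\sum_i (c i * \1_(A i) w)%:E + (Num.max 0 B * \1_N w)%:E)%E.
have int_ind (r : R) (S : set T) : 0 <= r -> measurable S ->
    (\int[P]_w (r * \1_S w)%:E = r%:E * P S)%E.
  move=> r0 mS; under eq_integral do rewrite EFinM.
  rewrite ge0_integralZl_EFin//.
    by rewrite integral_indic// setIT.
  by apply/measurable_EFinP; exact: measurable_indic.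
have mind (r : R) (S : set T) : measurable S ->
    measurable_fun setT (fun w => (r * \1_S w)%:E).
  move=> mS; apply/measurable_EFinP; apply: measurable_funM.
    exact: measurable_cst.
  exact: measurable_indic.
have B0 : 0 <= Num.max 0 B by rewrite le_max lexx.
apply: (@le_trans _ _ (\int[P]_w G w)%E).
  apply: expectation_monotone => // w; rewrite /G.
  have [/N0N Nw|/gc[i Aw gci]] := pselect (N0 w).
    rewrite [\1_N w]indicE mem_set// mulr1.
    apply: (@le_trans _ _ (0 + (Num.max 0 B)%:E)%E).
      by rewrite add0e lee_fin le_max gB orbT.
    apply: leeD => //; apply: sume_ge0 => i _.
    by rewrite lee_fin mulr_ge0.
  apply: (@le_trans _ _ ((c i * \1_(A i) w)%:E + 0)%E).
    by rewrite adde0 lee_fin indicE mem_set// mulr1.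
  apply: leeD; last by rewrite lee_fin mulr_ge0.
  rewrite (bigD1 i)//= leeDl// sume_ge0// => j _.
  by rewrite lee_fin mulr_ge0.
rewrite /G ge0_integralD//=.
- rewrite int_ind// [P N]PN mule0 adde0 ge0_integral_sum//=.
  + by apply: lee_sum => i _; rewrite int_ind.
  + by move=> i; exact: mind.
  + by move=> i w _; rewrite lee_fin mulr_ge0.
- by move=> w _; apply: sume_ge0 => i _; rewrite lee_fin mulr_ge0.
- by apply: emeasurable_sum => i; exact: mind.
- by move=> w _; rewrite lee_fin mulr_ge0.
- exact: mind.
Qed.

Section Grid.
Variables (f : R -> R) (omega : int -> {RV P >-> R}) (M0 : R).
Hypothesis indep : mutually_independent omega.
Hypothesis dens : forall k, has_density (omega k) f.
Hypothesis supp : forall x, M0 < `|x| -> f x = 0.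

Lemma measurable_preimage_RV k (A : set R) : measurable A ->
  measurable (omega k @^-1` A).
Proof. by move=> mA; rewrite -[_ @^-1` _]setTI; exact: measurable_funP. Qed.

Lemma density_integral : (\int[lebesgue_measure]_x (f x)%:E = 1)%E.
Proof.
have [mf f0 fE] := dens 0.
by rewrite -fE// probability_setT.
Qed.

Lemma density_zero (A : set R) : measurable A -> (forall x, A x -> M0 < `|x|) ->
  (\int[lebesgue_measure]_(x in A) (f x)%:E = 0)%E.
Proof.
move=> mA AM; apply: integral0_eq => x Ax; rewrite supp//.
exact: AM.
Qed.

Lemma unbounded_negligible : P.-negligible [set w | exists k, M0 < `|omega k w|].
Proof.
have neg k : P.-negligible [set w | M0 < `|omega k w|].
  have mS : measurable [set x : R | M0 < `|x|].
    have -> : [set x : R | M0 < `|x|] = `]-oo, (- M0)%R[%classic `|` `]M0, +oo[%classic.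
      apply/seteqP; split => x /=; rewrite !in_itv/= andbT.
        by rewrite lter_normr => /orP[h|h]; [right|left]; lra.
      by rewrite lter_normr; case=> h; apply/orP; [right|left]; lra.
    by apply: measurableU; exact: measurable_itv.
  have mX : measurable [set w | M0 < `|omega k w|].
    exact: (measurable_preimage_RV k mS).
  apply/negligibleP => //.
  have [mf f0 fE] := dens k; have := fE _ mS; rewrite density_zero//.
apply: negligibleS (negligible_bigcup (mu := P)
  (F := fun n => [set w | M0 < `|omega n%:Z w|] `|` [set w | M0 < `|omega (- n%:Z) w|]) _).
  move=> w [k hk]; exists `|k|%N => //=.
  have [e|e] : k = `|k|%N%:Z \/ k = - `|k|%N%:Z by lia.
    by left; rewrite -e.
  by right; rewrite -e.
by move=> n; apply: negligibleU; exact: neg.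
Qed.

Variables (x0 h : R).
Hypothesis h0 : 0 < h.

Definition cell (i : nat) : set R := `[x0 + h * i%:R, x0 + h * i.+1%:R[%classic.

Lemma cell_prob k i : P (omega k @^-1` cell i) = (cell_mass f x0 h i)%:E.
Proof.
have [mf f0 fE] := dens k.
have mc : measurable (cell i) by exact: measurable_itv.
rewrite /cell_mass fineK; first exact: (fE _ mc).
by rewrite -(fE _ mc) fin_num_measure.
Qed.

Lemma cell_mass_ge0 i : 0 <= cell_mass f x0 h i.
Proof. by rewrite -lee_fin -(cell_prob 0). Qed.

Lemma cell_mass_sum n : \sum_(i < n) cell_mass f x0 h i <= 1.
Proof.
have hn : (\sum_(i < n) cell_mass f x0 h i)%:E
   = P (omega 0 @^-1` `[x0, x0 + h * n%:R[%classic).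
  elim: n => [|n IH].
    by rewrite big_ord0 mulr0 addr0 set_itvco0 preimage_set0 measure0.
  rewrite big_ord_recr/= EFinD IH -(cell_prob 0) -measureU.
  - rewrite -preimage_setU; congr (P (_ @^-1` _)).
    have hle : h * n%:R <= h * n.+1%:R by rewrite ler_pM2l// ler_nat.
    have hn0 : 0 <= h * n%:R by rewrite mulr_ge0// ltW.
    apply/seteqP; split => x /=; rewrite /cell/= !in_itv/=.
      by case=> /andP[h1 h2]; apply/andP; split; lra.
    move=> /andP[h1 h2]; have [h3|h3] := ltP x (x0 + h * n%:R).
      by left; rewrite h1.
    by right.
  - by apply: measurable_preimage_RV; exact: measurable_itv.
  - by apply: measurable_preimage_RV; exact: measurable_itv.
  - apply/seteqP; split => x //=; rewrite /cell/= !in_itv/= => -[/andP[h1 h2] /andP[h3 h4]].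
    by move: (le_lt_trans h3 h2); rewrite ltxx.
by rewrite -lee_fin hn probability_le1//; apply: measurable_preimage_RV; exact: measurable_itv.
Qed.

(** Independence over the finite set of sites {-n, ..., n}; [A] prolongs the
    chosen cells to a family indexed by all sites, as the product rule needs. *)
Lemma cell_joint_prob (n : nat) (iota : 'I_n.*2.+1 -> nat) :
  P (\bigcap_(j in [set: 'I_n.*2.+1]) (omega (j%:Z - n%:Z) @^-1` cell (iota j)))
  = (\prod_j cell_mass f x0 h (iota j))%:E.
Proof.
pose site (j : 'I_n.*2.+1) : int := j%:Z - n%:Z.
have site_inj : injective site by move=> i j /addIr [] /val_inj.
pose J : {fset int} := [fset site j | j in 'I_n.*2.+1]%fset.
pose A (k : int) : set R := cell (iota (inord (absz (k + n%:Z)%R))).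
have AE j : A (site j) = cell (iota j).
  by rewrite /A /site subrK absz_nat inord_val.
have := indep J (A := A) (fun k => measurable_itv _).
rewrite big_imfset/=; last by move=> i j _ _; exact: site_inj.
rewrite big_enum/= (eq_bigr (fun j => (cell_mass f x0 h (iota j))%:E)); last first.
  by move=> j _; rewrite AE cell_prob.
rewrite prodEFin => <-; congr (P _).
apply/seteqP; split => [w hw k /= /imfsetP[j _ ->]|w hw j _].
  by rewrite AE; exact: hw.
have := hw (site j); rewrite /= AE; apply.
by apply/imfsetP; exists j.
Qed.

Lemma cell_mass_eq0 i :
  (forall x, x \in `[x0 + h * i%:R, x0 + h * i.+1%:R[ -> M0 < `|x|) ->
  cell_mass f x0 h i = 0.
Proof.
move=> hi; rewrite /cell_mass density_zero//= => x xi; exact: hi.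
Qed.

(** The first and the last cell carry no mass, so the wrap-around term vanishes. *)
Lemma cyclic_variation_le Q : in_BV f ->
  cell_mass f x0 h 0 = 0 -> cell_mass f x0 h Q.+1 = 0 ->
  cyclic_variation (fun i : 'I_Q.+2 => cell_mass f x0 h i) <= h * BVnorm f.
Proof.
move=> bv p0 pmax; have [mf f0 fE] := dens 0.
have pred0 : nat_of_ord (ord0 - 1 : 'I_Q.+2) = Q.+1.
  by rewrite /= add0n modn_mod [(1 %% _)%N]modn_small// subn1/= modn_small.
have predS (i : 'I_Q.+1) : nat_of_ord (lift ord0 i - 1 : 'I_Q.+2) = i.
  rewrite /= /bump/= [(1 %% _)%N]modn_small// subn1/= [(Q.+1 %% _)%N]modn_small//.
  by rewrite add1n addSnnS modnDr modn_small// ltnW// ltnS.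
rewrite /cyclic_variation big_ord_recl pred0.
rewrite p0 pmax subrr normr0 add0r.
have := cell_increment_sum x0 Q.+1 (ltW h0) mf f0 bv _.
rewrite density_integral => /(_ (ltry _)); apply: le_trans.
by apply: ler_sum => i _; rewrite predS.
Qed.

End Grid.

(** [G] may be evaluated at any approximation [y] of the variables up to [h];
    rounding down to the grid provides one, and the mean of [G] over the grid is
    estimated by [grid_mean_shift].  Monotonicity of [G] along the shift makes
    the dominating simple function nonnegative. *)
Lemma expectation_shift_le (f : R -> R) (omega : int -> {RV P >-> R}) (M0 h B Bg : R)
    (n : nat) (g : T -> R) (G : 'rV[R]_n.*2.+1 -> R) (z : 'I_n.*2.+1 -> int) :
  mutually_independent omega -> (forall k, has_density (omega k) f) ->
  in_BV f -> (forall x, M0 < `|x| -> f x = 0) -> 0 < h -> 0 <= M0 ->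
  (forall y, 0 <= G y) -> (forall y, G y <= B) ->
  (forall y, G (y + \row_j (h * (z j)%:~R)) <= G y) ->
  (forall w, 0 <= g w) -> (forall w, g w <= Bg) ->
  (forall w (y : 'rV[R]_n.*2.+1), (forall k, `|omega k w| <= M0) ->
     (forall j : 'I_n.*2.+1, `|omega (j%:Z - n%:Z) w - y 0 j| <= h) ->
     g w <= G y - G (y + \row_j (h * (z j)%:~R))) ->
  ('E_P[g] <= (B * (h * BVnorm f) * (\sum_j `|z j|%N)%:R)%:E)%E.
Proof.
move=> indep dens bv supp h0 M00 G0 GB Gmono g0 gB gG.
(* One empty cell on either side of [-M0, M0], for the first and last index. *)
pose x0 := - M0 - 2 * h.
pose Q := (Num.trunc ((2 * M0 + 2 * h) / h)).+1.
have hQ : 2 * M0 + 2 * h < h * Q%:R.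
  by rewrite [h * _]mulrC -ltr_pdivrMr// /Q; exact: truncnS_gt.
pose p (i : 'I_Q.+2) := cell_mass f x0 h i.
have p0 : cell_mass f x0 h 0 = 0.
  apply: (cell_mass_eq0 supp) => x; rewrite in_itv/= => /andP[h1 h2].
  by rewrite lter_normr; apply/orP; right; rewrite /x0 in h2; lra.
have pmax : cell_mass f x0 h Q.+1 = 0.
  apply: (cell_mass_eq0 supp) => x; rewrite in_itv/= => /andP[h1 h2].
  rewrite lter_normr; apply/orP; left; rewrite /x0 -natr1 in h1; lra.
have p_ge0 i : 0 <= p i by exact: (cell_mass_ge0 dens).
have p_sum : \sum_i p i <= 1 by exact: (cell_mass_sum dens).
pose Phi y := G y - G (y + \row_j (h * (z j)%:~R)).
have Phi0 y : 0 <= Phi y by rewrite subr_ge0.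
apply: (@le_trans _ _ (grid_mean p x0 h Phi)%:E); last first.
  rewrite lee_fin.
  apply: (@le_trans _ _ (B * cyclic_variation p * (\sum_j `|z j|%N)%:R)).
    apply: le_trans (grid_mean_shift x0 h p_ge0 p_sum pmax z G0 GB).
    rewrite /grid_mean -sumrB; apply: ler_sum => iota _.
    by rewrite mulrBr.
  have B0 : 0 <= B by exact: le_trans (G0 0) (GB 0).
  rewrite ler_wpM2r// ler_wpM2l//.
  exact: (cyclic_variation_le dens).
pose A (iota : {ffun 'I_n.*2.+1 -> 'I_Q.+2}) : set T :=
  \bigcap_(j in [set: 'I_n.*2.+1]) (omega (j%:Z - n%:Z) @^-1` cell x0 h (iota j)).
apply: (@le_trans _ _ (\sum_(iota : {ffun 'I_n.*2.+1 -> 'I_Q.+2})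
    (Phi (grid_vector x0 h iota))%:E * P (A iota))%E); last first.
  rewrite /grid_mean -sumEFin; apply: lee_sum => iota _.
  by rewrite /A (cell_joint_prob indep dens) -EFinM mulrC.
apply: (expectation_le_simple g0 gB _ _ (unbounded_negligible dens supp)).
- by move=> iota; exact: Phi0.
- move=> iota; apply: fin_bigcap_measurable => // j _.
  by apply: measurable_preimage_RV; exact: measurable_itv.
move=> w Nw.
have wM k : `|omega k w| <= M0.
  by rewrite leNgt; apply/negP => hk; apply: Nw; exists k.
pose idx (x : R) : nat := Num.trunc ((x - x0) / h).
have idxP x : `|x| <= M0 -> x0 + h * (idx x)%:R <= x < x0 + h * (idx x).+1%:R.
  rewrite ler_norml => /andP[h1 h2].
  have xx0 : 0 <= (x - x0) / h by rewrite divr_ge0 ?(ltW h0)// /x0; lra.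
  have := truncn_itv xx0; rewrite -/(idx x) ler_pdivlMr// ltr_pdivrMr//.
  by rewrite ![_ * h]mulrC => /andP[h3 h4]; apply/andP; split; lra.
have idx_lt x : `|x| <= M0 -> (idx x < Q.+2)%N.
  move=> xM; have /andP[h1 _] := idxP x xM; move: xM; rewrite ler_norml => /andP[h2 h3].
  rewrite -(ltr_nat R) -(ltr_pM2l h0) -[Q.+2]addn2 natrD mulrDr.
  rewrite /x0 in h1; lra.
pose iota : {ffun 'I_n.*2.+1 -> 'I_Q.+2} :=
  [ffun j : 'I_n.*2.+1 => inord (idx (omega (j%:Z - n%:Z) w))].
have iotaE j : iota j = idx (omega (j%:Z - n%:Z) w) :> nat.
  by rewrite ffunE inordK// idx_lt.
exists iota.
  move=> j _ /=; rewrite /cell/= in_itv/= iotaE; exact: idxP.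
apply: gG => // j.
rewrite mxE /grid_point iotaE; have /andP[h1 h2] := idxP _ (wM (j%:Z - n%:Z)).
rewrite -natr1 mulrDr mulr1 in h2.
by rewrite ler_norml; apply/andP; split; lra.
Qed.

End Expectation.

(** * The box matrix and the truncated potential *)

Section BoxMatrix.
Local Open Scope complex_scope.
Variables (R : realType) (H0 : @symmetric_operator R) (L : nat).

Definition box_matrix : 'M[R[i]]_L.+1 :=
  \matrix_(i, j) box_restr L (H0 (box_incl (delta_mx j 0))) i 0.

Lemma box_incl_delta (j : 'I_L.+1) (k : int) :
  box_incl (delta_mx j 0 : 'cV[R[i]]_L.+1) k = (k == j%:Z)%:R.
Proof.
rewrite /box_incl; have [->|kj] := eqVneq k j%:Z.
  rewrite (bigD1 j)//= eqxx mxE !eqxx big1 ?addr0// => i /negbTE ij.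
  by rewrite mxE ij /= if_same.
rewrite big1// => i _; case: eqP => // ki; rewrite mxE andbT.
by case: eqP => // ij; rewrite ki ij eqxx in kj.
Qed.

Lemma op_dom_box_incl (j : 'I_L.+1) : op_dom H0 (box_incl (delta_mx j 0)).
Proof.
apply: op_dom_finsupp; apply: (@sub_finite_set _ _ [set j%:Z]) => // k /=.
by rewrite box_incl_delta; case: (k =P j%:Z) => // _; rewrite eqxx.
Qed.

(** Test the symmetry of [H0] on pairs of basis vectors. *)
Lemma hermsym_box_matrix : box_matrix \is hermsymmx.
Proof.
apply/is_hermitianmxP; rewrite expr0 scale1r; apply/matrixP => i j; rewrite !mxE.
have := op_fun_symmetric (op_dom_box_incl i) (op_dom_box_incl j).
rewrite /innerZ (@sumZ_single _ _ j%:Z); last first.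
  by move=> k /negbTE kj; rewrite box_incl_delta kj mulr0.
rewrite (@sumZ_single _ _ i%:Z); last first.
  by move=> k /negbTE ki; rewrite box_incl_delta ki mulr0n conjC0 mul0r.
by rewrite !box_incl_delta !eqxx mulr1n mulr1 conjC1 mul1r => <-.
Qed.

Lemma box_hamiltonianE (V : int -> R) :
  box_hamiltonian H0 V L = diag_pert box_matrix (fun i => V i%:Z).
Proof. by []. Qed.

End BoxMatrix.

Lemma compact_support_bounded (R : realType) (f : R -> R) : compact_support f ->
  exists2 M, 0 <= M & forall x, M < `|x| -> f x = 0.
Proof.
move=> /compact_bounded [M [_ HM]]; exists (`|M| + 1); first by rewrite addr_ge0.
move=> x Mx; apply/eqP/negP => /negP fx.
have h : M < `|M| + 1 by rewrite (le_lt_trans (ler_norm M))// ltrDl.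
have xS : closure [set x | f x != 0] x by apply: subset_closure; exact: fx.
by have := HM _ h x xS; rewrite /= leNgt Mx.
Qed.

Lemma eventually_expr_le (R : realType) (s x : R) : 0 <= s -> s < 1 -> 0 < x ->
  exists N0, forall n, (N0 <= n)%N -> s ^+ n <= x.
Proof.
move=> s0 s1 xp; have : (GRing.exp s : R ^nat) @ \oo --> 0.
  by apply: cvg_expr; rewrite ger0_norm.
move=> /cvgrPdist_le /(_ x xp)[N0 _ HN]; exists N0 => n /HN /=.
by rewrite sub0r normrN ger0_norm// exprn_ge0.
Qed.

Section Potential.
Variables (R : realType) (u : int -> R) (s C M0 : R) (L : nat).
Hypotheses (s0 : 0 < s) (s1 : s < 1) (C0 : 0 < C) (hu : exp_decay u s C).
Hypothesis M00 : 0 <= M0.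

(* Since |x - k| >= |k| - L on the box, a translate of [u] decays from the
   origin with this constant. *)
Let B := C / s ^+ L.

Lemma box_decay (x : nat) : (x <= L)%N -> exp_decay (fun k => u (x%:Z - k)) s B.
Proof.
move=> xL k; apply: (le_trans (hu _)); rewrite /B -mulrA ler_pM2l//.
rewrite mulrC ler_pdivlMr ?exprn_gt0// -exprD.
by apply: ler_wiXn2l; [exact: ltW|exact: ltW|lia].
Qed.

(** Two errors: the sites outside {-n, ..., n} contribute the tail of a
    geometrically convergent series, those inside at most [h] times the total
    mass of [u], which is bounded uniformly over the box. *)
Lemma truncated_potential_close (eta : R) : 0 < eta ->
  exists h0 n0, 0 < h0 /\ forall (h : R) (n : nat) (a : int -> R)
      (y : 'I_n.*2.+1 -> R) (x : nat),
    0 <= h -> h <= h0 -> (n0 <= n)%N -> (x <= L)%N ->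
    (forall k, `|a k| <= M0) ->
    (forall j : 'I_n.*2.+1, `|a (j%:Z - n%:Z) - y j| <= h) ->
    `|sumZ (fun k => a k * u (x%:Z - k))
      - \sum_(j < n.*2.+1) y j * u (x%:Z - (j%:Z - n%:Z))| <= eta.
Proof.
move=> eta0; have B0 : 0 < B by rewrite divr_gt0// exprn_gt0.
have s1' : 0 < 1 - s by rewrite subr_gt0.
pose U := B + 2 * B * s / (1 - s).
have U0 : 0 < U.
  apply: addr_gt0 => //; apply: divr_gt0 => //; apply: mulr_gt0 => //; exact: mulr_gt0.
pose W := 2 * ((M0 + 1) * B) / (1 - s).
have M1 : 0 < M0 + 1 by rewrite ltr_wpDl.
have W0 : 0 < W by apply: divr_gt0 => //; apply: mulr_gt0 => //; exact: mulr_gt0.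
have [n0 Hn0] := eventually_expr_le (ltW s0) s1 (divr_gt0 (divr_gt0 eta0 (ltr0n R 2)) W0).
exists (eta / 2 / U), n0; split; first by rewrite !divr_gt0//.
move=> h n a y x hp hh n0n xL aM ay.
have dec : exp_decay (fun k => a k * u (x%:Z - k)) s ((M0 + 1) * B).
  move=> k; rewrite normrM -mulrA ler_pM//; last exact: box_decay.
  by rewrite (le_trans (aM k))// lerDl.
have tail := sumZ_tail n (ltW s0) s1 dec.
have near : `|psumZ (fun k => a k * u (x%:Z - k)) n
      - \sum_(j < n.*2.+1) y j * u (x%:Z - (j%:Z - n%:Z))| <= h * U.
  rewrite /psumZ -sumrB (le_trans (ler_norm_sum _ _ _))//.
  apply: (@le_trans _ _ (\sum_(j < n.*2.+1) h * `|u (x%:Z - (j%:Z - n%:Z))|)).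
    by apply: ler_sum => j _; rewrite -mulrBl normrM ler_wpM2r.
  rewrite -mulr_sumr ler_wpM2l//.
  have decn : exp_decay (fun k => `|u (x%:Z - k)|) s B.
    by move=> k; rewrite normr_id; exact: box_decay.
  have := psumZ_tail_le 0 n (ltW s0) s1 decn; rewrite add0n psumZ0 expr1 => t0.
  rewrite -/(psumZ (fun k => `|u (x%:Z - k)|) n).
  have t1 := decn 0; rewrite expr0 mulr1 in t1.
  have := ler_norm (psumZ (fun k => `|u (x%:Z - k)|) n - `|u (x%:Z - 0)|).
  have := ler_norm `|u (x%:Z - 0)|.
  by rewrite /U; lra.
have h1 : h * U <= eta / 2 by rewrite -ler_pdivlMr.
have h2 : 2 * ((M0 + 1) * B) * s ^+ n.+1 / (1 - s) <= eta / 2.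
  rewrite mulrAC -/W mulrC -ler_pdivlMr//; apply: Hn0; exact: leqW.
apply: (le_trans (ler_distD (psumZ (fun k => a k * u (x%:Z - k)) n) _ _)).
lra.
Qed.

End Potential.

(** * The Wegner estimate *)

(** In units of the mesh: [r] times sigma k^D at the site k = j - n, cut off at
    |k| <= N. *)
Definition window_shift (N n r : nat) (sigma : int) (D : nat) (j : 'I_n.*2.+1) : int :=
  if (`|j%:Z - n%:Z|%R <= N%:Z)%R then r%:Z * sigma * (j%:Z - n%:Z) ^+ D else 0.

Lemma window_shift_potential (R : realType) (u : int -> R) (N n r D x : nat)
    (sigma : int) (h : R) : (N <= n)%N ->
  \sum_(j < n.*2.+1) h * (window_shift N r sigma D j)%:~R * u (x%:Z - (j%:Z - n%:Z))
  = h * r%:R * (sigma%:~R * psumZ (fun k : int => k%:~R ^+ D * u (x%:Z - k)) N).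
Proof.
move=> Nn; rewrite -(psumZ_truncate _ Nn) /psumZ !mulr_sumr; apply: eq_bigr => j _.
rewrite /window_shift -abszE lez_nat; case: ifP => _.
  by rewrite !intrM rmorphXn/= ; ring.
by rewrite mulr0 mul0r !mulr0.
Qed.

Lemma window_shift_norm (R : realType) (N n r D : nat) (sigma : int) :
  (N <= n)%N -> `|sigma|%N = 1%N ->
  (\sum_j `|@window_shift N n r sigma D j|%N)%:R
    <= r%:R * (N.*2.+1%:R * N%:R ^+ D) :> R.
Proof.
move=> Nn sigma1; rewrite natr_sum.
pose a (k : int) : R := (`|k|%N)%:R ^+ D.
rewrite (eq_bigr (fun j : 'I_n.*2.+1 => r%:R *
    (fun k => if (`|k| <= N)%N then a k else 0) (j%:Z - n%:Z))); last first.
  move=> j _; rewrite /window_shift -abszE lez_nat /=; case: ifP => _; last first.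
    by rewrite mulr0.
  by rewrite !abszM sigma1 muln1 abszX natrM natrX absz_nat.
rewrite -mulr_sumr ler_wpM2l//.
rewrite -/(psumZ (fun k => if (`|k| <= N)%N then a k else 0) n) psumZ_truncate//.
rewrite /psumZ (@le_trans _ _ (\sum_(i < N.*2.+1) N%:R ^+ D))//.
  apply: ler_sum => i _; rewrite lerXn2r ?nnegrE// ler_nat.
  by have := ltn_ord i; lia.
by rewrite sumr_const card_ord mulr_natl.
Qed.

Theorem theorem6 (R : realType) (u : int -> R)
  (u_neq0 : exists k : int, u k != 0)
  (u_decay : exists s C : R, [/\ 0 < s, s < 1, 0 < C & exp_decay u s C]) :
  exists (c_u : R) (D : nat), 0 < c_u /\
  forall (s C : R), 0 < s -> s < 1 -> 0 < C -> exp_decay u s C ->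
  forall (H0 : @symmetric_operator R) (f : R -> R),
    in_BV f -> compact_support f ->
  forall (d : measure_display) (T : measurableType d) (P : probability T R)
         (omega : int -> {RV P >-> R}),
    mutually_independent omega ->
    (forall k : int, has_density (omega k) f) ->
  forall beta : R, D%:R / `|ln s| < beta ->
  exists K_beta : R, 0 < K_beta /\
  forall (L : nat) (E eps : R), (0 < L)%N -> 0 < eps ->
    ('E_P[fun w => trace_spectral_projection [set x : R | E - eps <= x <= E + eps]%R
                     (box_hamiltonian H0 (alloy_potential omega u w) L)]
     <= (8%:R / c_u * BVnorm f * eps * L%:R
         * (L%:R + beta * ln L%:R + K_beta) ^+ D.+1)%:E)%E.
Proof.
have [s0 [C0 [s0_gt0 s0_lt1 C0_gt0 hu0]]] := u_decay.
have [D [mD mlt]] := first_nonzero_moment s0_gt0 s0_lt1 hu0 u_neq0.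
pose c := `|moment u D|; have c_gt0 : 0 < c by rewrite normr_gt0.
(* 8 / (c / 6) = 2 * (8 / c) * 3 collects the factors lost in L + 1 <= 2 L, in
   the choice of the shift t <= 8 eps / c, and in 2 N + 1 <= 3 rho. *)
exists (c / 6), D; split; first by rewrite divr_gt0.
move=> s C s_gt0 s_lt1 C_gt0 hu H0 f bv csupp d T P omega indep dens beta hbeta.
(* The omitted part of the sum will cost at most c / 2, half of its value. *)
have [K K1 HK] := window_lower_bound s_gt0 s_lt1 C_gt0 hu hbeta (divr_gt0 c_gt0 (ltr0n R 2)).
exists K; split; first exact: lt_le_trans K1.
move=> L E eps L0 eps0.
have [M0 M00 supp] := compact_support_bounded csupp.
have beta0 : 0 < beta by apply: le_lt_trans hbeta; rewrite divr_ge0.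
have L1 : (1 : R) <= L%:R by rewrite ler1n.
set rho := L%:R + beta * ln L%:R + K.
have rho1 : 1 <= rho by have := mulr_ge0 (ltW beta0) (ln_ge0 L1); rewrite /rho; lra.
pose N := Num.trunc rho.
have /andP[Nrho rhoN] : N%:R <= rho < N.+1%:R by apply: truncn_itv; lra.
(* The sign for which moving the coupling constants along [sg * k ^ D] raises
   the potential. *)
pose sg : int := sgz ((-1) ^+ D * moment u D).
have sg1 : `|sg|%N = 1%N.
  by rewrite /sg; case: sgzP => // /eqP; rewrite mulf_eq0 signr_eq0 (negbTE mD).
have window x : (x <= L)%N ->
    c / 2 <= sg%:~R * psumZ (fun k : int => k%:~R ^+ D * u (x%:Z - k)) N.
  move=> xL; have := HK L x N L0 xL (ltW rhoN).
  rewrite (convolution_pow s_gt0 s_lt1 hu _ mlt) => close.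
  have sgc : sg%:~R * ((-1) ^+ D * moment u D) = c.
    by rewrite /sg -sgrEz -normrEsg /c normrM normrX normrN normr1 expr1n mul1r.
  have : `|sg%:~R * ((-1) ^+ D * moment u D)
     - sg%:~R * psumZ (fun k : int => k%:~R ^+ D * u (x%:Z - k)) N| <= c / 2.
    by rewrite -mulrBr normrM -intr_norm -abszE sg1 mul1r.
  by rewrite sgc ler_norml => /andP[]; lra.
have [h0 [n0 [h0_gt0 Hclose]]] :=
  truncated_potential_close L s_gt0 s_lt1 C_gt0 hu M00 (divr_gt0 eps0 (ltr0n R 2)).
pose n := maxn n0 N.
have n0n : (n0 <= n)%N by rewrite leq_maxl.
have Nn : (N <= n)%N by rewrite leq_maxr.
(* The mesh must be fine enough for the rounding error and for some multiple
   h r to lie between 6 eps / c and 8 eps / c. *)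
pose h := Num.min h0 (2 * eps / c).
have h_gt0 : 0 < h by rewrite lt_min h0_gt0 divr_gt0// mulr_gt0.
have hh0 : h <= h0 by rewrite ge_min lexx.
have hc : h <= 2 * eps / c by rewrite ge_min lexx orbT.
pose r := (Num.trunc (6 * eps / c / h)).+1.
have [r1 r2] : 6 * eps / c < h * r%:R /\ h * r%:R <= 8 * eps / c.
  have xx : 0 <= 6 * eps / c / h by rewrite !divr_ge0// ?mulr_ge0// ltW.
  have /andP[t1 t2] := truncn_itv xx; split; first by rewrite [h * _]mulrC -ltr_pdivrMr.
  move: t1; rewrite ler_pdivlMr// [_ * h]mulrC => t1; rewrite /r -natr1 mulrDr mulr1.
  have -> : 8 * eps / c = 6 * eps / c + 2 * eps / c by rewrite -mulrDl; congr (_ / _); ring.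
  exact: lerD.
pose z := @window_shift N n r sg D.
pose M := box_matrix H0 L.
have Mh : M \is hermsymmx by exact: hermsym_box_matrix.
pose V (y : 'rV[R]_n.*2.+1) (i : 'I_L.+1) : R :=
  \sum_(j < n.*2.+1) y 0 j * u (i%:Z - (j%:Z - n%:Z)).
(* The upper end of the interval, raised by the error eps / 2 made in replacing
   the potential by [V]. *)
pose lam := E + eps + eps / 2.
pose G y : R := (eigenvalue_count (diag_pert M (V y)) lam)%:R.
have G0 y : 0 <= G y by exact: ler0n.
have GB y : G y <= L.+1%:R by rewrite ler_nat eigenvalue_count_le_size.
have Vshift y i : V y i + h * r%:R * (c / 2) <= V (y + \row_j (h * (z j)%:~R)) i.
  rewrite /V; under [X in _ <= X]eq_bigr do rewrite !mxE mulrDl.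
  rewrite big_split/= lerD2l window_shift_potential//.
  rewrite ler_wpM2l ?mulr_ge0 ?(ltW h_gt0)//; apply: window.
  by rewrite -ltnS.
(* 3 eps = 2 eps + 2 (eps / 2): the length of the interval plus the error made
   at either end. *)
have hrc : 3 * eps < h * r%:R * (c / 2).
  move: r1; rewrite ltr_pdivrMr// => r1.
  by rewrite mulrA ltr_pdivlMr//; lra.
have Gmono y : G (y + \row_j (h * (z j)%:~R)) <= G y.
  rewrite ler_nat -[X in (_ <= eigenvalue_count _ X)%N](addr0 lam).
  apply: eigenvalue_count_shift => // i.
  by have := Vshift y i; lra.
apply: le_trans (expectation_shift_le (h := h) (G := G) (B := L.+1%:R) (Bg := L.+1%:R)
  (M0 := M0) (z := z) indep dens bv supp h_gt0 M00 G0 GB Gmono _ _ _) _.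
- by move=> w; exact: trace_spectral_projection_ge0.
- by move=> w; exact: trace_spectral_projection_le.
- move=> w y wM wy; rewrite box_hamiltonianE -/M.
  have close (i : 'I_L.+1) : `|alloy_potential omega u w i%:Z - V y i| <= eps / 2.
    by apply: (Hclose h n (fun k => omega k w) (y 0) i) => //; [exact: ltW|rewrite -ltnS].
  apply: le_trans (trace_interval_le _ (a' := lam + (eps / 2 - h * r%:R * (c / 2))) _ _) _.
  + by rewrite /lam; lra.
  + by lra.
  apply: lerB.
    rewrite ler_nat /lam; apply: eigenvalue_count_shift => // i.
    by have := close i; rewrite ler_norml => /andP[]; lra.
  rewrite ler_nat; apply: eigenvalue_count_shift => // i.
  have := close i; rewrite ler_norml => /andP[h1 h2].
  by have := Vshift y i; lra.
rewrite lee_fin.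
have BV0 := BVnorm_ge0 bv.
have rho0 : 0 <= rho by lra.
apply: (@le_trans _ _ (L.+1%:R * (h * BVnorm f) * (r%:R * (N.*2.+1%:R * N%:R ^+ D)))).
  rewrite ler_wpM2l ?mulr_ge0 ?(ltW h_gt0)//.
  exact: window_shift_norm.
have hN : N.*2.+1%:R * N%:R ^+ D <= 3 * rho ^+ D.+1.
  rewrite exprS mulrA ler_pM//.
    by rewrite -natr1 -mul2n natrM; lra.
  by rewrite lerXn2r ?nnegrE.
have hL : L.+1%:R <= 2 * L%:R :> R by rewrite -natr1; lra.
apply: (@le_trans _ _ (2 * L%:R * ((8 * eps / c) * BVnorm f) * (3 * rho ^+ D.+1))).
  rewrite [X in X <= _](_ : _ =
    L.+1%:R * ((h * r%:R) * BVnorm f) * (N.*2.+1%:R * N%:R ^+ D)); last by ring.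
  have hr0 : 0 <= h * r%:R by rewrite mulr_ge0// ltW.
  have hrBV : 0 <= h * r%:R * BVnorm f by rewrite mulr_ge0.
  apply: ler_pM; last exact: hN.
  - by rewrite mulr_ge0.
  - by rewrite mulr_ge0// exprn_ge0.
  - by apply: ler_pM => //; rewrite ler_wpM2r.
rewrite le_eqVlt; apply/orP; left; apply/eqP.
by field; rewrite gt_eqF.
Qed.
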